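(* Let $(M,\pi)$ be a Poisson manifold, let $c$ be a Casimir function for $\pi$, and let $\lambda\in\mathbb{R}$. For any Poisson vector fields $X,Y$ on $M$ such that $[X,Y]=0$, with complete lifts $X_C,Y_C$ and vertical lift $Y_V$ to $TM$, the bivector fields $$\pi_{TM,X_C,Y_V,c}=\pi_{TM}+\lambda\, c(\mathbf{x})\,X_C\wedge Y_V,$$ $$\pi_{TM,X_C,Y_C,c}=\pi_{TM}+\lambda\, c(\mathbf{x})\,X_C\wedge Y_C$$ are Poisson tensors on $TM$.
   Context: All manifolds, functions and tensors are smooth. A bivector field $P$ is a Poisson tensor if the bracket $\{f,g\}=P(df,dg)$ satisfies the Jacobi identity (equivalently, the Schouten--Nijenhuis bracket $[P,P]$ vanishes). On a Poisson manifold $(M,\pi)$ with $\{f,g\}=\pi(df,dg)$, a Casimir function is a $c\in C^\infty(M)$ with $\{\cdot,c\}=0$, and a Poisson vector field is a vector field $X$ with $\mathcal{L}_X\pi=0$. Local coordinates $\mathbf{x}=(x^1,\dots,x^N)$ on $M$ induce coordinates $(\mathbf{x},\mathbf{y})=(x^1,\dots,x^N,y^1,\dots,y^N)$ on $TM$, where $y^i$ is the fiber-wise linear function defined by $dx^i$. With $\pi^{ij}=\{x^i,x^j\}$, the Poisson tensor on $TM$ induced by $\pi$ is $$\pi_{TM}(\mathbf{x},\mathbf{y})=\sum_{i,j} \pi^{ij}(\mathbf{x})\frac{\partial}{\partial x^i}\wedge \frac{\partial}{\partial y^j}+\frac12\sum_{i,j,s}\frac{\partial\pi^{ij}}{\partial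 x^s}(\mathbf{x})\,y^s\frac{\partial}{\partial y^i}\wedge \frac{\partial}{\partial y^j}.$$ For $X=\sum_i v^i(\mathbf{x})\frac{\partial}{\partial x^i}$ the complete and vertical lifts are the vector fields on $TM$ given by $X_{C}=\sum_{i} v^i(\mathbf{x})\frac{\partial}{\partial x^i}+\sum_{i,s} \frac{\partial v^i}{\partial x^s}(\mathbf{x})\,y^s\frac{\partial}{\partial y^i}$ and $X_{V}=\sum_{i} v^i(\mathbf{x})\frac{\partial}{\partial y^i}$. The factor $c(\mathbf{x})$ on $TM$ means $c\circ q_M$, with $q_M:TM\to M$ the projection. *)

(* Defs.v *)
From mathcomp Require Import all_boot all_order all_algebra.
From mathcomp Require Import all_classical all_reals all_analysis.

Set Implicit Arguments.
Unset Strict Implicit.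
Unset Printing Implicit Defensive.

Import Order.TTheory GRing.Theory Num.Theory.
Import numFieldNormedType.Exports.

Local Open Scope classical_set_scope.
Local Open Scope ring_scope.

Section SmoothFunctions.
Variables (R : realType) (n : nat).
Implicit Types (U : set 'rV[R]_n) (f : 'rV[R]_n -> R).

Definition pderiv (a : 'I_n) f (x : 'rV[R]_n) : R := 'D_(delta_mx 0 a) f x.

(* Used only for open [U]; then differentiability and partial derivatives at
   points of [U] do not depend on the values of [f] outside [U]. *)
Fixpoint Ck (k : nat) U f : Prop :=
  if k is k'.+1 then
    (forall x, U x -> differentiable f x) /\
    (forall a, Ck k' U (pderiv a f))
  else forall x, U x -> {for x, continuous f}.

Definition smooth_on U f : Prop := forall k, Ck k U f.

End SmoothFunctions.

(* A family of charts [coord i : dom i -> R^n], given with inverses [param i].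
   The maps are total; their values outside [dom i], respectively outside
   [coord i @` dom i], are irrelevant. The field [chart_at] selects a chart
   around each point. *)
Record atlas (R : realType) (n : nat) (T : Type) := Atlas {
  chart_index : Type;
  dom : chart_index -> set T;
  coord : chart_index -> T -> 'rV[R]_n;
  param : chart_index -> 'rV[R]_n -> T;
  chart_at : T -> chart_index
}.

Section Manifolds.
Variables (R : realType) (n : nat).

Section Atlas.
Variables (T : Type) (A : atlas R n T).

Definition chart_image (i : chart_index A) : set 'rV[R]_n :=
  coord i @` dom i.

Definition overlap (i j : chart_index A) : set 'rV[R]_n :=
  coord i @` (dom i `&` dom j).

Definition transition (i j : chart_index A) : 'rV[R]_n -> 'rV[R]_n :=
  coord j \o param i.

(* For [i = j] the third clause says that [chart_image i] is open. *)
Definition smooth_atlas : Prop :=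
  [/\ forall p, dom (chart_at A p) p,
      forall (i : chart_index A) p, dom i p -> param i (coord i p) = p,
      forall i j : chart_index A, open (overlap i j)
    & forall (i j : chart_index A) (b : 'I_n),
        smooth_on (overlap i j) (fun x => transition i j x 0 b)].

Definition smooth_fun (f : T -> R) : Prop :=
  forall i : chart_index A, smooth_on (chart_image i) (f \o param i).

(* Tensor fields are given by their components in every chart, subject to the
   transformation law. With row vectors, ['J F x] has the entry
   d(F^b)/d(x^a) in row [a] and column [b]. *)
Definition components (V : Type) := chart_index A -> 'rV[R]_n -> V.

Definition is_vector_field (X : components 'rV[R]_n) : Prop :=
  (forall i b, smooth_on (chart_image i) (fun x => X i x 0 b)) /\
  (forall i j x, overlap i j x ->
     X j (transition i j x) = X i x *m 'J (transition i j) x).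

(* The matrix [P i x] has the entries [P(dx^a, dx^b)]. *)
Definition is_bivector_field (P : components 'M[R]_n) : Prop :=
  [/\ forall i a b, smooth_on (chart_image i) (fun x => P i x a b),
      forall i x, chart_image i x -> (P i x)^T = - P i x
    & forall i j x, overlap i j x ->
        P j (transition i j x) =
          ('J (transition i j) x)^T *m P i x *m 'J (transition i j) x].

(* [P(df, dg)]; for a bivector field, the value does not depend on the chart
   around [p] in which it is computed. *)
Definition bracket (P : components 'M[R]_n) (f g : T -> R) (p : T) : R :=
  let i := chart_at A p in
  let x := coord i p in
  \sum_a \sum_b
    P i x a b * pderiv a (f \o param i) x * pderiv b (g \o param i) x.

Definition is_poisson (P : components 'M[R]_n) : Prop :=
  is_bivector_field P /\
  forall f g h, smooth_fun f -> smooth_fun g -> smooth_fun h ->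
    forall p, bracket P f (bracket P g h) p + bracket P g (bracket P h f) p
              + bracket P h (bracket P f g) p = 0.

Definition is_casimir (P : components 'M[R]_n) (c : T -> R) : Prop :=
  smooth_fun c /\
  forall f, smooth_fun f -> forall p, bracket P f c p = 0.

Definition lie_bracket (X Y : components 'rV[R]_n) : components 'rV[R]_n :=
  fun i x => \row_a \sum_s
    (X i x 0 s * pderiv s (fun x' => Y i x' 0 a) x
     - Y i x 0 s * pderiv s (fun x' => X i x' 0 a) x).

Definition commute_fields (X Y : components 'rV[R]_n) : Prop :=
  forall i x, chart_image i x -> lie_bracket X Y i x = 0.

Definition lie_derivative (X : components 'rV[R]_n) (P : components 'M[R]_n)
    : components 'M[R]_n :=
  fun i x => \matrix_(a, b) \sum_s
    (X i x 0 s * pderiv s (fun x' => P i x' a b) x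
     - P i x s b * pderiv s (fun x' => X i x' 0 a) x
     - P i x a s * pderiv s (fun x' => X i x' 0 b) x).

Definition is_poisson_vector_field (P : components 'M[R]_n)
    (X : components 'rV[R]_n) : Prop :=
  is_vector_field X /\
  forall i x, chart_image i x -> lie_derivative X P i x = 0.

End Atlas.

Definition smooth_manifold (M : topologicalType) (A : atlas R n M) : Prop :=
  [/\ hausdorff_space M, @second_countable M, smooth_atlas A
    & forall i : chart_index A,
        [/\ open (dom i),
            forall p, dom i p -> {for p, continuous (coord i)}
          & forall x, chart_image i x -> {for x, continuous (param i)}]].

(* For [u = \sum_a u^a d_a] and [v = \sum_b v^b d_b], the matrix of values of
   [u /\ v] on pairs of coordinate differentials. *)
Definition wedge (u v : 'rV[R]_n) : 'M[R]_n := u^T *m v - v^T *m u.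

End Manifolds.

Section TangentBundle.
Variables (R : realType) (N : nat) (M : Type) (A : atlas R N M).

(* The pair [(p, v) : M * 'rV_N] stands for the tangent vector at [p] whose
   components in the chart [chart_at A p] are [v]. The chart induced on TM by
   the chart [i] of M maps a tangent vector at [p] to [row_mx x y], where [x]
   holds the coordinates of [p] and [y] the components of the vector, both in
   the chart [i]. *)
Definition tangent_atlas : atlas R (N + N) (M * 'rV[R]_N) :=
  {| chart_index := chart_index A;
     dom := fun i => [set q | dom i q.1];
     coord := fun i q =>
       let k := chart_at A q.1 in
       row_mx (coord i q.1) (q.2 *m 'J (transition k i) (coord k q.1));
     param := fun i z =>
       let x := lsubmx z in
       let p := param i x in
       (p, rsubmx z *m 'J (transition i (chart_at A p)) x);
     chart_at := fun q => chart_at A q.1 |}.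

Definition ddx (a : 'I_N) : 'rV[R]_(N + N) := delta_mx 0 (lshift N a).
Definition ddy (a : 'I_N) : 'rV[R]_(N + N) := delta_mx 0 (rshift N a).

Definition tangent_bivector (P : components A 'M[R]_N)
    : components tangent_atlas 'M[R]_(N + N) :=
  fun i z =>
    let x : 'rV[R]_N := lsubmx z in
    let y : 'rV[R]_N := rsubmx z in
    \sum_a \sum_b P i x a b *: wedge (ddx a) (ddy b)
    + 2^-1 *: (\sum_a \sum_b \sum_s
        (pderiv s (fun x' => P i x' a b) x * y 0 s) *: wedge (ddy a) (ddy b)).

Definition complete_lift (X : components A 'rV[R]_N)
    : components tangent_atlas 'rV[R]_(N + N) :=
  fun i z =>
    let x : 'rV[R]_N := lsubmx z in
    let y : 'rV[R]_N := rsubmx z in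
    \sum_a X i x 0 a *: ddx a
    + \sum_a \sum_s (pderiv s (fun x' => X i x' 0 a) x * y 0 s) *: ddy a.

Definition vertical_lift (X : components A 'rV[R]_N)
    : components tangent_atlas 'rV[R]_(N + N) :=
  fun i z => \sum_a X i (lsubmx z) 0 a *: ddy a.

(* The bivector field pi_TM + lambda (c o q_M) Z /\ W on TM, with
   [q_M = fst]. *)
Definition deformed_tangent_bivector (P : components A 'M[R]_N) (lambda : R)
    (c : M -> R) (Z W : components tangent_atlas 'rV[R]_(N + N))
    : components tangent_atlas 'M[R]_(N + N) :=
  fun i z =>
    tangent_bivector P i z
    + (lambda * c (param (a := tangent_atlas) i z).1) *: wedge (Z i z) (W i z).

End TangentBundle.

(* Main.v *)
From Pilot Require Import Defs.
From mathcomp Require Import all_boot all_order all_algebra.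
From mathcomp Require Import all_classical all_reals all_analysis.
From mathcomp Require Import ring.

Set Implicit Arguments.
Unset Strict Implicit.
Unset Printing Implicit Defensive.

Import Order.TTheory GRing.Theory Num.Theory.
Import numFieldNormedType.Exports.
(* Gives [coord] back its meaning as a chart, hidden by vector coordinates. *)
Import Pilot.Defs.

Local Open Scope classical_set_scope.
Local Open Scope ring_scope.

(** Both bivector fields have the form [P + g Z /\ W] on the manifold TM, where
    [P] is the lifted Poisson tensor, [g] is a Casimir function of [P], and [Z],
    [W] are commuting Poisson vector fields of [P].  Such a deformation is always
    Poisson ([deform_poisson]).  Its Jacobi sum is a polynomial of degree two in
    [g] and its derivatives.  The part of degree zero is the Jacobi sum of [P].
    The part of degree one vanishes because [Z] and [W] are derivations of the
    bracket of [P] and [g] is central for it.  The part of degree two is the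
    Jacobi sum of [g Z /\ W], which vanishes because a trivector tangent to the
    two-dimensional foliation spanned by the commuting fields [Z] and [W] is zero.

    It remains to see that lifting to TM preserves these hypotheses.  A function
    [f] of the coordinates [x] has a vertical lift [f_V(x, y) = f(x)] and a
    complete lift [f_C(x, y) = sum_s y^s d_s f(x)] ([vlift], [clift]), and in the
    induced charts all components of the lifted tensor and of the lifted fields
    are zero, vertical lifts or complete lifts.  Even the rows of the matrix of
    the lifted tensor are the vertical and the complete lifts of the rows of the
    original one.  With the classical rules
      [X_C f_C = (X f)_C],  [X_C f_V = X_V f_C = (X f)_V],  [X_V f_V = 0]
    ([cfield_clift], [cfield_vlift], [vfield_clift], [vfield_vlift]), each
    identity to be proved on TM is zero or a lift of the same identity on M.
    The first rule rests on the symmetry of second partial derivatives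
    ([pderivC]), obtained from the mean value theorem for second differences.

    The Jacobi identity and the Casimir condition concern functions on the whole
    manifold, while the computations take place in charts.  In a chart, the Jacobi
    sum of [f], [g], [h] is [sum_abc J^abc d_a f d_b g d_c h], where [J^abc] is
    the Jacobi sum of three coordinates ([jacobi_param]).  Reading off [J^abc = 0]
    from the identity for global functions requires global smooth functions with
    prescribed differential at a point: a coordinate times a bump function,
    extended by zero, which is smooth since M is Hausdorff
    ([smooth_fun_with_pderiv]). *)

(** * Partial derivatives *)
Section Calculus.
Context {R : realType}.

(** [g] is [f] plus a function that vanishes near [x], and the latter has the
    zero map as its differential. *)
Lemma near_differentiable n (f g : 'rV[R]_n -> R) x :
  (\near x, f x = g x) -> differentiable f x -> differentiable g x.
Proof.
move=> fg df.
have -> : g = f + (g - f) by rewrite addrC subrK.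
apply: differentiableD => //.
have h0 : \near x, (g - f) x = 0.
  near=> y; have fgy : f y = g y by near: y.
  by rewrite -[LHS]/(g y - f y) fgy subrr.
have hx : (g - f) x = 0 := nbhs_singleton h0.
have [c0 o0] : continuous (0 : 'rV[R]_n -> R) /\
   (g - f) \o shift x = cst ((g - f) x) + \0 +o_ 0 id.
  split; first exact: cst_continuous.
  rewrite hx; apply/eqaddoP => e e0; near=> y.
  have -> : ((g - f) \o shift x - (cst 0 + \0)) y = 0.
    have -> : ((g - f) \o shift x - (cst 0 + \0)) y = (g - f) (y + x) - (0 + 0).
      by [].
    have -> : (g - f) (y + x) = 0.
      by near: y; move: h0; rewrite (near_shift 0) subr0 /=.
    by rewrite !addr0 subrr.
  by rewrite normr0 mulr_ge0 // ltW.
have d0 : 'd (g - f) x = \0 :> ('rV[R]_n -> R) by exact: diff_unique.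
by apply/diff_locallyP; rewrite d0.
Unshelve. all: by end_near. Qed.

Lemma pderivE n (a : 'I_n) (f : 'rV[R]_n -> R) x :
  differentiable f x -> pderiv a f x = 'd f x (delta_mx 0 a).
Proof. exact: deriveE. Qed.

Lemma near_pderiv n (a : 'I_n) (f g : 'rV[R]_n -> R) x :
  (\near x, f x = g x) -> pderiv a f x = pderiv a g x.
Proof. exact: near_eq_derive. Qed.

Lemma pderivD n (a : 'I_n) (f g : 'rV[R]_n -> R) x :
  differentiable f x -> differentiable g x ->
  pderiv a (fun y => f y + g y) x = pderiv a f x + pderiv a g x.
Proof. by move=> df dg; rewrite /pderiv deriveD //; exact: diff_derivable. Qed.

Lemma pderivN n (a : 'I_n) (f : 'rV[R]_n -> R) x :
  differentiable f x -> pderiv a (fun y => - f y) x = - pderiv a f x.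
Proof. by move=> df; rewrite /pderiv deriveN //; exact: diff_derivable. Qed.

Lemma pderivM n (a : 'I_n) (f g : 'rV[R]_n -> R) x :
  differentiable f x -> differentiable g x ->
  pderiv a (fun y => f y * g y) x = pderiv a f x * g x + f x * pderiv a g x.
Proof.
move=> df dg; rewrite /pderiv deriveM; try exact: diff_derivable.
by rewrite addrC [g x *: _]mulrC.
Qed.

Lemma pderiv_cst n (a : 'I_n) (k : R) x : pderiv a (fun=> k) x = 0.
Proof. exact: derive_cst. Qed.

Lemma pderiv_sum n m (a : 'I_n) (f : 'I_m -> 'rV[R]_n -> R) x :
  (forall i, differentiable (f i) x) ->
  pderiv a (fun y => \sum_i f i y) x = \sum_i pderiv a (f i) x.
Proof.
move=> df; rewrite /pderiv.
have -> : (fun y => \sum_i f i y) = \sum_i f i.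
  by apply/funext => y; rewrite fct_sumE.
by rewrite derive_sum // => i; exact: diff_derivable.
Qed.

Lemma pderiv_coord n (a b : 'I_n) (x : 'rV[R]_n) :
  pderiv a (fun y : 'rV[R]_n => y 0 b) x = (a == b)%:R.
Proof.
have dx : derivable (id : 'rV[R]_n -> 'rV[R]_n) x (delta_mx 0 a).
  exact: derivable_id.
have /matrixP/(_ 0 b) := derive_mx dx.
by rewrite derive_id !mxE eqxx /= eq_sym => ->.
Qed.

Lemma differentiable_funD n (f g : 'rV[R]_n -> R) x :
  differentiable f x -> differentiable g x ->
  differentiable (fun y => f y + g y) x.
Proof. exact: differentiableD. Qed.

Lemma differentiable_funM n (f g : 'rV[R]_n -> R) x :
  differentiable f x -> differentiable g x ->
  differentiable (fun y => f y * g y) x.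
Proof. exact: differentiableM. Qed.

Lemma differentiable_funN n (f : 'rV[R]_n -> R) x :
  differentiable f x -> differentiable (fun y => - f y) x.
Proof. exact: differentiableN. Qed.

Lemma differentiable_funsum n m (f : 'I_m -> 'rV[R]_n -> R) x :
  (forall i, differentiable (f i) x) ->
  differentiable (fun y => \sum_i f i y) x.
Proof.
move=> df; have -> : (fun y => \sum_i f i y) = \sum_i f i.
  by apply/funext => y; rewrite fct_sumE.
exact: differentiable_sum.
Qed.

(** A vector-valued function is the sum of its components times the constant
    basis vectors. *)
Lemma differentiable_row n m (F : 'rV[R]_n -> 'rV[R]_m) x :
  (forall b, differentiable (fun y => F y 0 b) x) -> differentiable F x.
Proof.
move=> dF; have -> : F = \sum_b (fun y => F y 0 b *: delta_mx 0 b).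
  by apply/funext => y; rewrite fct_sumE -row_sum_delta.
by apply: differentiable_sum => b; exact: differentiableZl.
Qed.

Lemma jacobianE n m (F : 'rV[R]_n -> 'rV[R]_m) x a b :
  (forall b, differentiable (fun y => F y 0 b) x) ->
  ('J F x) a b = pderiv a (fun y => F y 0 b) x.
Proof.
move=> dF; rewrite mxE -deriveE; last exact: differentiable_row.
rewrite derive_mx ?mxE //.
by apply: diff_derivable; exact: differentiable_row.
Qed.

Lemma pderiv_comp n m (F : 'rV[R]_n -> 'rV[R]_m) (f : 'rV[R]_m -> R) x a :
  (forall b, differentiable (fun y => F y 0 b) x) ->
  differentiable f (F x) ->
  pderiv a (f \o F) x =
  \sum_b pderiv a (fun y => F y 0 b) x * pderiv b f (F x).
Proof.
move=> dF df; have dF' := differentiable_row dF.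
rewrite pderivE; last exact: differentiable_comp.
rewrite diff_comp //= [in LHS](row_sum_delta ('d F x (delta_mx 0 a)))
  linear_sum.
apply: eq_bigr => b _; rewrite linearZ /= -jacobianE // /jacobian mxE.
by rewrite -pderivE.
Qed.
End Calculus.

(** * Smooth functions on open sets *)
Section Smooth.
Context {R : realType}.
Implicit Types n m k : nat.

(** Since [pderiv] is a total operator, [Ck k U f] is a condition at each point
    of [U] separately; hence the covering sets may be arbitrary. *)
Lemma Ck_cover n k (U : set 'rV[R]_n) f :
  (forall x, U x -> exists2 V, V x & Ck k V f) -> Ck k U f.
Proof.
elim: k f => [|k IH] f Uf; first by move=> x /Uf[V Vx]; apply.
split=> [x /Uf[V Vx [df _]]|a]; first exact: df.
by apply: IH => x /Uf[V Vx [_ /(_ a) Vf]]; exists V.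
Qed.

(** Openness is what makes the partial derivatives of [f] and [g] agree on [U]
    again, so that the induction on the order can proceed. *)
Lemma Ck_congr n k (U : set 'rV[R]_n) f g : open U ->
  (forall x, U x -> f x = g x) -> Ck k U f -> Ck k U g.
Proof.
move=> oU; have near_U h h' x : (forall x, U x -> h x = h' x) -> U x ->
    \near x, h x = h' x :> R.
  by move=> hh' Ux; near=> y; apply: hh'; near: y; exact: open_nbhs_nbhs.
elim: k f g => [|k IH] f g fg.
  move=> cf x Ux; have cfx : f @ x --> f x := cf x Ux.
  have : g @ x --> f x.
    exact: cvg_trans (near_eq_cvg (near_U _ _ _ fg Ux)) cfx.
  by rewrite (fg x Ux).
move=> [df pf]; split=> [x Ux|a].
  by apply: near_differentiable (df x Ux); exact: near_U.
by apply: IH (pf a) => x Ux; apply/near_pderiv/near_U.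
Unshelve. all: by end_near. Qed.

Lemma Ck_pred n k (U : set 'rV[R]_n) f : Ck k.+1 U f -> Ck k U f.
Proof.
elim: k f => [|k IH] f [df pf].
  by move=> x Ux; exact/differentiable_continuous/df.
by split=> // a; apply: IH.
Qed.

Lemma CkD n k (U : set 'rV[R]_n) f g : open U ->
  Ck k U f -> Ck k U g -> Ck k U (fun x => f x + g x).
Proof.
move=> oU; elim: k f g => [|k IH] f g.
  by move=> cf cg x Ux; apply: continuousD; [exact: cf|exact: cg].
move=> [df pf] [dg pg]; split=> [x Ux|a].
  by apply: differentiable_funD; [exact: df|exact: dg].
apply: Ck_congr (IH _ _ (pf a) (pg a)) => // x Ux.
by rewrite pderivD //; [exact: df|exact: dg].
Qed.

Lemma CkM n k (U : set 'rV[R]_n) f g : open U ->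
  Ck k U f -> Ck k U g -> Ck k U (fun x => f x * g x).
Proof.
move=> oU; elim: k f g => [|k IH] f g.
  by move=> cf cg x Ux; apply: continuousM; [exact: cf|exact: cg].
move=> cf cg; have [df pf] := cf; have [dg pg] := cg; split=> [x Ux|a].
  by apply: differentiable_funM; [exact: df|exact: dg].
apply: (@Ck_congr _ _ _ (fun x => pderiv a f x * g x + f x * pderiv a g x)) =>
  //.
  by move=> x Ux; rewrite pderivM //; [exact: df|exact: dg].
apply: CkD => //; first by apply: IH; [exact: pf|exact: Ck_pred].
by apply: IH; [exact: Ck_pred|exact: pg].
Qed.

Lemma Ck_cst n k (U : set 'rV[R]_n) (c : R) : Ck k U (fun=> c).
Proof.
elim: k c => [|k IH] c; first by move=> x _; exact: cst_continuous.
split=> [x _|a]; first exact: differentiable_cst.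
by have -> : pderiv a (fun=> c) = fun=> 0 by apply/funext => x;
  exact: pderiv_cst.
Qed.

Lemma Ck_coord n k (U : set 'rV[R]_n) b : Ck k U (fun x => x 0 b).
Proof.
case: k => [|k]; first by move=> x _; exact: coord_continuous.
split=> [x _|a]; first exact: differentiable_coord.
have -> : pderiv a (fun x : 'rV[R]_n => x 0 b) = fun=> (a == b)%:R.
  by apply/funext => x; exact: pderiv_coord.
exact: Ck_cst.
Qed.

Lemma continuous_row n m (F : 'rV[R]_n -> 'rV[R]_m) x :
  (forall b, {for x, continuous (fun x => F x 0 b)}) -> {for x, continuous F}.
Proof.
move=> cF; have Fcvg e : 0 < e -> \forall y \near x, `|F x - F y| <= e.
  move=> e0; near=> y.
  rewrite [leLHS]/Num.Def.normr /= mx_normrE (bigmax_le _ (ltW e0)) //= => i _.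
  rewrite !mxE (ord1 i.1); move: i; near: y; apply: filter_forall => i.
  exact: ((cvgrPdist_le _ _).1 (cF i.2)).
exact: (iffRL (@cvgrPdist_le _ _ _ (nbhs x) _ F (F x))).
Unshelve. all: by end_near. Qed.

(** Induction on the order: by the chain rule, a partial derivative of the
    composite is a sum of products of functions of lower order, one factor of
    which is again a composite with [F]. *)
Lemma Ck_comp n m k (U : set 'rV[R]_n) (V : set 'rV[R]_m)
    (F : 'rV[R]_n -> 'rV[R]_m) f : open U -> open V ->
  (forall x, U x -> V (F x)) -> (forall b, Ck k U (fun x => F x 0 b)) ->
  Ck k V f -> Ck k U (f \o F).
Proof.
move=> oU oV UV; elim: k f => [|k IH] f cF cf.
  move=> x Ux; apply: continuous_comp; last exact/cf/UV.
  by apply: continuous_row => b; exact: cF.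
have [df pf] := cf.
have dF x : U x -> forall b, differentiable (fun x => F x 0 b) x.
  by move=> Ux b; have [d _] := cF b; exact: d.
split=> [x Ux|a].
  by apply: differentiable_comp; [exact/differentiable_row/dF|exact/df/UV].
apply: (@Ck_congr _ _ _
  (fun x => \sum_b pderiv a (fun y => F y 0 b) x * (pderiv b f \o F) x)) => //.
  by move=> x Ux; rewrite pderiv_comp //; [exact: dF|exact/df/UV].
have Csum (s : seq 'I_m) (h : 'I_m -> 'rV[R]_n -> R) :
    (forall b, Ck k U (h b)) -> Ck k U (fun x => \sum_(b <- s) h b x).
  move=> ch; elim: s => [|b s IHs].
    by under eq_fun do rewrite big_nil; exact: Ck_cst.
  by under eq_fun do rewrite big_cons; exact: CkD.
apply: Csum => b; apply: CkM => //; first by have [_] := cF b; apply.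
by apply: IH; [move=> b'; exact: Ck_pred|exact: pf].
Qed.

Lemma smooth_on_cover n (U : set 'rV[R]_n) f :
  (forall x, U x -> exists2 V, V x & smooth_on V f) -> smooth_on U f.
Proof.
by move=> Uf k; apply: Ck_cover => x /Uf[V Vx Vf]; exists V.
Qed.

Lemma smooth_on_congr n (U : set 'rV[R]_n) f g : open U ->
  (forall x, U x -> f x = g x) -> smooth_on U f -> smooth_on U g.
Proof. by move=> oU fg sf k; exact: Ck_congr oU fg (sf k). Qed.

Lemma smooth_onD n (U : set 'rV[R]_n) f g : open U ->
  smooth_on U f -> smooth_on U g -> smooth_on U (fun x => f x + g x).
Proof. by move=> oU sf sg k; exact: CkD oU (sf k) (sg k). Qed.

Lemma smooth_onM n (U : set 'rV[R]_n) f g : open U ->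
  smooth_on U f -> smooth_on U g -> smooth_on U (fun x => f x * g x).
Proof. by move=> oU sf sg k; exact: CkM oU (sf k) (sg k). Qed.

Lemma smooth_on_cst n (U : set 'rV[R]_n) (c : R) : smooth_on U (fun=> c).
Proof. by move=> k; exact: Ck_cst. Qed.

Lemma smooth_on_coord n (U : set 'rV[R]_n) b : smooth_on U (fun x => x 0 b).
Proof. by move=> k; exact: Ck_coord. Qed.

Lemma smooth_onN n (U : set 'rV[R]_n) f : open U ->
  smooth_on U f -> smooth_on U (fun x => - f x).
Proof.
move=> oU sf; under eq_fun do rewrite -mulN1r.
by apply: smooth_onM => //; exact: smooth_on_cst.
Qed.

Lemma smooth_onB n (U : set 'rV[R]_n) f g : open U ->
  smooth_on U f -> smooth_on U g -> smooth_on U (fun x => f x - g x).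
Proof. by move=> oU sf sg; apply: smooth_onD => //; exact: smooth_onN. Qed.

Lemma smooth_on_sum n (I : Type) (s : seq I) (U : set 'rV[R]_n)
    (f : I -> 'rV[R]_n -> R) : open U ->
  (forall i, smooth_on U (f i)) -> smooth_on U (fun x => \sum_(i <- s) f i x).
Proof.
move=> oU sf; elim: s => [|i s IHs].
  by under eq_fun do rewrite big_nil; exact: smooth_on_cst.
by under eq_fun do rewrite big_cons; exact: smooth_onD.
Qed.

Lemma smooth_on_comp n m (U : set 'rV[R]_n) (V : set 'rV[R]_m)
    (F : 'rV[R]_n -> 'rV[R]_m) f : open U -> open V ->
  (forall x, U x -> V (F x)) -> (forall b, smooth_on U (fun x => F x 0 b)) ->
  smooth_on V f -> smooth_on U (f \o F).
Proof. by move=> oU oV UV sF sf k; apply: Ck_comp oV UV _ (sf k) => // b;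
  exact: sF. Qed.

Lemma smooth_on_differentiable n (U : set 'rV[R]_n) f x :
  smooth_on U f -> U x -> differentiable f x.
Proof. by move=> sf Ux; have [+ _] := sf 1%N; apply. Qed.

Lemma smooth_on_pderiv n (U : set 'rV[R]_n) f a :
  smooth_on U f -> smooth_on U (pderiv a f).
Proof. by move=> sf k; have [_ /(_ a)] := sf k.+1. Qed.

End Smooth.

(** * Symmetry of second partial derivatives *)
Section Schwarz.
Context {R : realType} {n : nat}.
Implicit Types (f g : 'rV[R]_n -> R) (x u v : 'rV[R]_n).

(** The difference quotients of [f] along the line and at the point are the same
    function. *)
Lemma is_derive_line f x v (t : R) : differentiable f (x + t *: v) ->
  is_derive t 1 (fun s : R => f (x + s *: v)) ('D_v f (x + t *: v)).
Proof.
move=> df.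
have E : (fun h : R => h^-1 *:
  (((fun s : R => f (x + s *: v)) \o shift t) (h *: 1)
            - (fun s : R => f (x + s *: v)) t)) =
         (fun h : R => h^-1 *: ((f \o shift (x + t *: v)) (h *: v) - f
           (x + t *: v))).
  apply/funext => h /=; congr (_ *: (f _ - _)).
  by rewrite [h%:A]mulr1 scalerDl addrCA.
apply: DeriveDef; last by rewrite /derive E.
by rewrite /derivable E; exact: diff_derivable.
Qed.

Lemma mean_value_line f x v (h : R) : 0 < h ->
  (forall t, 0 <= t <= h -> differentiable f (x + t *: v)) ->
  exists2 t, 0 <= t <= h & f (x + h *: v) - f x = 'D_v f (x + t *: v) * h.
Proof.
move=> h0 df; have dl t : t \in `[0, h] ->
    is_derive t 1 (fun s : R => f (x + s *: v)) ('D_v f (x + t *: v)).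
  by rewrite in_itv => th; apply/is_derive_line/df.
have sub : {subset `]0, h[ <= `[0, h]} by exact: subset_itv_oo_cc.
have cl : {within `[0, h], continuous (fun s : R => f (x + s *: v))}.
  by apply: derivable_within_continuous => t /dl[].
have [t /sub] := @MVT R _ (fun t => 'D_v f (x + t *: v)) 0 h h0
                      (fun t th => dl t (sub t th)) cl.
rewrite in_itv scale0r addr0 subr0 => th E; by exists t.
Qed.

Lemma derive_comp_shift f u v x :
  'D_v (fun y => f (y + u)) x = 'D_v f (x + u).
Proof. by rewrite /derive; under eq_fun do rewrite /= -addrA. Qed.

(** The mean value theorem is applied twice: along [u] to the increment of [f] in
    the direction [v], and then along [v] to the derivative of [f] along [u]. *)
Lemma second_difference f u v x (h r : R) : 0 < h -> h * (`|u| + `|v|) < r ->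
  (forall y, ball x r y -> differentiable f y) ->
  (forall y, ball x r y -> differentiable ('D_u f) y) ->
  exists2 y, ball x r y &
    f (x + h *: u + h *: v) - f (x + h *: u) - (f (x + h *: v) - f x) =
    'D_v ('D_u f) y * h * h.
Proof.
move=> h0 hr df ddf.
have inB s t : 0 <= s <= h -> 0 <= t <= h -> ball x r (x + s *: u + t *: v).
  move=> /andP[s0 sh] /andP[t0 th].
  rewrite -ball_normE /= -addrA opprD addNKr normrN.
  apply: le_lt_trans hr; apply: le_trans (ler_normD _ _) _.
  by rewrite !normrZ mulrDr !ger0_norm // lerD // ler_wpM2r.
have h00 : 0 <= (0 : R) <= h by rewrite lexx ltW.
have hh : 0 <= h <= h by rewrite lexx ltW.
pose g y := f (y + h *: v) - f y.
have dshift y : ball x r (y + h *: v) ->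
  differentiable (fun z => f (z + h *: v)) y.
  move=> By; apply: (differentiable_comp (f := fun z => z + h *: v));
    last exact: df.
  exact: differentiableD.
have dfy s : 0 <= s <= h -> differentiable f (x + s *: u).
  by move=> sh; apply: df; have := inB s 0 sh h00; rewrite scale0r addr0.
have [s sh Es] : exists2 s, 0 <= s <= h &
    g (x + h *: u) - g x = 'D_u g (x + s *: u) * h.
  apply: mean_value_line => // s sh.
  apply: differentiableB; last exact: dfy.
  exact/dshift/inB.
have [t th Et] : exists2 t, 0 <= t <= h &
    'D_u f (x + s *: u + h *: v) - 'D_u f (x + s *: u) =
    'D_v ('D_u f) (x + s *: u + t *: v) * h.
  exact: (@mean_value_line ('D_u f) (x + s *: u) v h h0
            (fun t th => ddf _ (inB s t sh th))).
exists (x + s *: u + t *: v); first exact: inB.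
rewrite -Et -derive_comp_shift -deriveB; last 2 first.
- by apply: diff_derivable; exact/dshift/inB.
- by apply: diff_derivable; exact: dfy.
have <- : f (x + h *: u + h *: v) - f (x + h *: u) - (f (x + h *: v) - f x) =
  'D_u g (x + s *: u) * h by exact: Es.
by [].
Qed.

(** The second difference is symmetric in its two directions.  So the two mixed
    derivatives take a common value at two points arbitrarily close to [x], and
    they agree at [x] by continuity. *)
Lemma pderivC (U : set 'rV[R]_n) f a b x : open U -> smooth_on U f -> U x ->
  pderiv a (pderiv b f) x = pderiv b (pderiv a f) x.
Proof.
move=> oU sf Ux; apply/eqP; rewrite -subr_eq0; apply/negPn/negP => neq.
set D1 := pderiv a (pderiv b f); set D2 := pderiv b (pderiv a f).
pose e : R := `|D1 x - D2 x| / 2.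
have e0 : 0 < e by rewrite divr_gt0 // normr_gt0.
have cont c d : \forall y \near x,
    `|pderiv c (pderiv d f) x - pderiv c (pderiv d f) y| < e.
  have /differentiable_continuous/cvgrPdist_lt :
      differentiable (pderiv c (pderiv d f)) x.
    apply: (smooth_on_differentiable (U := U)) => //.
    by do 2 apply: smooth_on_pderiv.
  by move=> /(_ e e0).
have : \forall y \near x, [/\ U y, `|D1 x - D1 y| < e & `|D2 x - D2 y| < e].
  have nU : nbhs x U by exact: open_nbhs_nbhs.
  apply: filterS (filterI nU (filterI (cont a b) (cont b a))) => y [Uy [d1 d2]].
  exact: And3 Uy d1 d2.
move=> /nbhs_ballP[r /= r0 Br].
pose u : 'rV[R]_n := delta_mx 0 a; pose v : 'rV[R]_n := delta_mx 0 b.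
pose C := `|u| + `|v| + 1; have C0 : 0 < C.
  by rewrite ltr_wpDl // addr_ge0.
pose h := r / C; have h0 : 0 < h by rewrite divr_gt0.
have hr : h * (`|u| + `|v|) < r.
  by rewrite /h mulrAC ltr_pdivrMr // ltr_pM2l // ltrDl.
have dB c y : ball x r y -> differentiable (pderiv c f) y.
  move=> /Br[Uy _ _]; apply: (smooth_on_differentiable (U := U)) => //.
  exact: smooth_on_pderiv.
have dfB y : ball x r y -> differentiable f y.
  by move=> /Br[Uy _ _]; exact: smooth_on_differentiable Uy.
(* The same second difference, read in the two orders. *)
have [y By Ey] := second_difference h0 hr dfB (dB a).
have hr' : h * (`|v| + `|u|) < r by rewrite addrC.
have [z Bz Ez] := second_difference h0 hr' dfB (dB b).
have D12 : D1 z = D2 y.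
  have hh : h != 0 by rewrite gt_eqF.
  apply: (mulIf hh); apply: (mulIf hh).
  rewrite [LHS](esym Ez) [RHS](esym Ey) (addrAC x (h *: v)).
  by ring.
have [_ h1 _] := Br z Bz; have [_ _ h2] := Br y By.
have close (p q s t d : R) : s = t -> `|p - s| < d -> `|q - t| < d ->
    `|p - q| < d + d.
  move=> -> pt; rewrite distrC => qt; rewrite -(subrKA t).
  by apply: le_lt_trans (ler_normD _ _) _; exact: ltrD.
have : `|D1 x - D2 x| < e + e := close _ _ _ _ _ D12 h1 h2.
by rewrite -splitr ltxx.
Qed.

End Schwarz.

(** * A flat function and bump functions *)
Section Flat.
Context {R : realType}.
Implicit Types (m : nat) (t : R).

(** For [m = 0] this is the flat function exp(-1/t).  The derivatives of the
    members of the family are combinations of members of the family, so that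
    smoothness can be proved for all [m] by one induction. *)
Definition flat m t : R := if 0 < t then t^-1 ^+ m * expR (- t^-1) else 0.

Lemma flat_gt0 m t : 0 < t -> 0 < flat m t.
Proof.
by move=> t0; rewrite /flat t0 mulr_gt0 ?exprn_gt0 ?invr_gt0 ?expR_gt0.
Qed.

Lemma flat_le0 m t : t <= 0 -> flat m t = 0.
Proof. by rewrite /flat leNgt => /negbTE ->. Qed.

(** With [s = 1/t] this says that [s ^+ m.+2] is at most [(m.+2)`! * exp s].  The
    bound is quadratic in [t] in order to give the derivative zero at [0]. *)
Lemma flat_bound m t : `|flat m t| <= (m.+2)`!%:R * t ^+ 2.
Proof.
have [t0|t0] := ltP 0 t; last first.
  by rewrite flat_le0 // normr0 mulr_ge0 ?ler0n ?sqr_ge0.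
rewrite ger0_norm ?(ltW (flat_gt0 _ _)) // /flat t0.
have [s s0 ->] : exists2 s, 0 < s & t = s^-1.
  by exists t^-1; rewrite ?invrK ?invr_gt0.
rewrite !invrK expRN exprVn ler_pdivlMr ?exprn_gt0 //.
rewrite mulrAC -exprD addn2 ler_pdivrMr ?expR_gt0 //.
rewrite mulrC -ler_pdivrMr ?ltr0n ?fact_gt0 //.
by apply: le_trans (expR_ge1Dxn m.+1 (ltW s0)); rewrite lerDr.
Qed.

Lemma is_derive_flat m t :
  is_derive t 1 (flat m) (flat m.+2 t - m%:R * flat m.+1 t).
Proof.
have [t0|t0|->] := ltgtP t 0.
- rewrite !flat_le0 ?(ltW t0) // mulr0 subr0.
  have nt : \near t, (cst 0 : R -> R) t = flat m t.
    by near=> u; rewrite flat_le0 //; apply/ltW; near: u; exact: lt_nbhsl.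
  exact: near_eq_is_derive nt (is_derive_cst _ _ _).
- have nt : \near t, t^-1 ^+ m * expR (- t^-1) = flat m t.
    by near=> u; rewrite /flat ifT //; near: u; exact: lt_nbhsr.
  apply: near_eq_is_derive nt _.
  have tn0 : t != 0 by rewrite gt_eqF.
  have dV : is_derive t 1 (fun u : R => u^-1) (- t ^- 2).
    by have := is_deriveV (f := id) tn0 (is_derive_id t 1); rewrite [_%:A]mulr1.
  have dN : is_derive t 1 (fun u : R => - u^-1) (t ^- 2).
    by rewrite -[t ^- 2]opprK; exact: (is_deriveN dV).
  have dE := is_derive1_comp (g := fun u : R => - u^-1)
    (is_derive_expR (- t^-1)) dN.
  have dX : is_derive t 1 (fun u : R => u^-1 ^+ m)
                          (m%:R * t^-1 ^+ m.-1 * - t ^- 2).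
    have dP : is_derive t^-1 1 (fun u : R => u ^+ m) (m%:R * t^-1 ^+ m.-1).
      apply: DeriveDef; first exact: exprn_derivable.
      by rewrite exp_derive [_%:A]mulr1.
    exact: (is_derive1_comp (f := fun u : R => u ^+ m)
      (g := fun u : R => u^-1)).
  apply: (is_derive_eq (is_deriveM dX dE)).
  have sE (x y : R) : x *: (y : R^o) = x * y by [].
  rewrite /flat t0 /= [_ *: (_ / _)]sE [_ *: (_ * - _)]sE -exprVn.
  case: (m) => [|k]; first by rewrite expr0 expr2; ring.
  by rewrite /= !exprS expr0; ring.
- rewrite !flat_le0 // mulr0 subr0.
  have cv : h^-1 *: ((flat m \o shift 0) (h *: 1) - flat m 0) @[h --> 0^'] -->
    (0:R).
    apply/cvgrPdist_le => e e0; near=> h.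
    have hn0 : h != 0 by near: h; exact: nbhs_dnbhs_neq.
    rewrite sub0r normrN /= addr0 [h%:A]mulr1 (@flat_le0 _ 0) // subr0 normrZ
      normfV.
    rewrite ler_pdivrMl ?normr_gt0 //; apply: le_trans (flat_bound m h) _.
    rewrite -(real_normK (num_real h)) expr2 mulrCA ler_wpM2l //.
    rewrite mulrC -ler_pdivlMr ?ltr0n ?fact_gt0 //; near: h.
    by apply: dnbhs0_le; rewrite divr_gt0 ?ltr0n ?fact_gt0.
  apply: DeriveDef; first by apply/cvg_ex; exists 0.
  exact/cvg_lim.
Unshelve. all: by end_near. Qed.
End Flat.

Section Bump.
Context {R : realType} {n : nat}.
Implicit Types (U : set 'rV[R]_n) (x p : 'rV[R]_n).

Lemma differentiable_flat_comp m (g : 'rV[R]_n -> R) x :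
  differentiable g x -> differentiable (fun x => flat m (g x)) x.
Proof.
move=> dg; apply: (differentiable_comp dg).
by apply/derivable1_diffP; have [] := is_derive_flat m (g x).
Qed.

Lemma pderiv_flat_comp m (g : 'rV[R]_n -> R) a x : differentiable g x ->
  pderiv a (fun x => flat m (g x)) x =
  (flat m.+2 (g x) - m%:R * flat m.+1 (g x)) * pderiv a g x.
Proof.
move=> dg; have [df Df] := is_derive_flat m (g x).
rewrite !pderivE //; last exact: differentiable_flat_comp.
have dF : differentiable (flat m) (g x) by apply/derivable1_diffP.
rewrite (diff_comp dg dF) /= -Df.
by rewrite diff1E // derive1E mulrC.
Qed.

(** Induction on the order of differentiability, for all [m] simultaneously. *)
Lemma smooth_on_flat_comp U m (g : 'rV[R]_n -> R) : open U ->
  smooth_on U g -> smooth_on U (fun x => flat m (g x)).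
Proof.
move=> oU sg k; have dg x : U x -> differentiable g x.
  exact: smooth_on_differentiable sg.
elim: k m => [|k IH] m.
  by move=> x Ux; apply/differentiable_continuous/differentiable_flat_comp/dg.
split=> [x Ux|a]; first exact/differentiable_flat_comp/dg.
apply: (@Ck_congr _ _ _ _ (fun x =>
  (flat m.+2 (g x) + (- m%:R) * flat m.+1 (g x)) * pderiv a g x)) => //.
  by move=> x Ux; rewrite pderiv_flat_comp ?mulNr //; exact: dg.
apply: CkM => //; last by have [_] := sg k.+1; apply.
by apply: CkD => //; apply: CkM => //; exact: Ck_cst.
Qed.

(** Positive at the centre, and zero outside the Euclidean ball of radius [r]. *)
Definition bump p (r : R) x : R :=
  flat 0 (r ^+ 2 - \sum_b (x 0 b - p 0 b) ^+ 2).

Lemma bump_smooth U p r : open U -> smooth_on U (bump p r).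
Proof.
move=> oU; apply: smooth_on_flat_comp => //.
apply: smooth_onB => //; first exact: smooth_on_cst.
apply: smooth_on_sum => // b; under eq_fun do rewrite expr2.
by apply: smooth_onM => //; apply: smooth_onB => //;
  [exact: smooth_on_coord|exact: smooth_on_cst|exact: smooth_on_coord|exact:
    smooth_on_cst].
Qed.

Lemma bump_center p r : 0 < r -> 0 < bump p r p.
Proof.
move=> r0; rewrite flat_gt0 // big1 ?subr0 ?exprn_gt0 // => b _.
by rewrite subrr expr0n.
Qed.

Lemma bump_support p r x : 0 < r -> bump p r x != 0 -> `|p - x| <= r.
Proof.
move=> r0; apply: contraR; rewrite -ltNge => rx; apply/eqP/flat_le0.
rewrite subr_le0.
have [b Hb] : exists b, r <= `|p 0 b - x 0 b|.
  apply: contrapT => /forallNP H; move: rx; rewrite ltNge => /negP; apply.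
  rewrite [leLHS]/Num.Def.normr /= mx_normrE (bigmax_le _ (ltW r0)) //= => i _.
  by rewrite !mxE (ord1 i.1) ltW // ltNge; exact/negP/H.
rewrite (bigD1 b) //= ler_wpDr ?sumr_ge0 // => [? _|]; first exact: sqr_ge0.
by rewrite -(real_normK (num_real (x 0 b - _))) distrC lerXn2r ?nnegrE // ltW.
Qed.

End Bump.

(** * Charts and transition maps *)
Section SmoothAtlas.
Context {R : realType} {n : nat} {T : Type} (A : atlas R n T).
Hypothesis hA : smooth_atlas A.
Implicit Types (i j k : chart_index A) (x : 'rV[R]_n) (p : T).

Lemma open_chart_image i : open (chart_image i).
Proof. by have [_ _ /(_ i i) + _] := hA; rewrite /overlap setIid. Qed.

Lemma coordK i p : dom i p -> param i (coord i p) = p.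
Proof. by have [_ + _ _] := hA; apply. Qed.

Lemma paramK i x : chart_image i x -> coord i (param i x) = x.
Proof. by case=> p Dp <-; rewrite coordK. Qed.

Lemma dom_param i x : chart_image i x -> dom i (param i x).
Proof. by case=> p Dp <-; rewrite coordK. Qed.

Lemma chart_image_coord i p : dom i p -> chart_image i (coord i p).
Proof. by exists p. Qed.

Lemma overlapP i j x : overlap i j x <-> chart_image i x /\ dom j (param i x).
Proof.
split=> [[p [ip jp] <-]|[[p ip <-]]]; rewrite coordK //; first by split=> //;
  exists p.
by move=> jp; exists p.
Qed.

Lemma param_transition i j x : overlap i j x ->
  param j (transition i j x) = param i x.
Proof. by move=> /overlapP[_ jx]; rewrite /transition /= coordK. Qed.

Lemma open_overlap i j : open (overlap i j).
Proof. by have [_ _ + _] := hA; apply. Qed.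

Lemma near_overlap i j x : overlap i j x -> \forall y \near x, overlap i j y.
Proof. by move=> ijx; apply: open_nbhs_nbhs; split=> //;
  exact: open_overlap. Qed.

Lemma transition_smooth i j b :
  smooth_on (overlap i j) (fun x => transition i j x 0 b).
Proof. by have [_ _ _] := hA; apply. Qed.

Lemma transition_differentiable i j x b : overlap i j x ->
  differentiable (fun x => transition i j x 0 b) x.
Proof. exact/smooth_on_differentiable/transition_smooth. Qed.

Lemma transition_jacobianE i j x a b : overlap i j x ->
  'J (transition i j) x a b = pderiv a (fun x => transition i j x 0 b) x.
Proof.
by move=> ijx; apply: jacobianE => c; exact: transition_differentiable.
Qed.

(** The cocycle rule: near [x] the transition from [i] to [k] factors through the
    chart [j]. *)
Lemma jacobian_transition_comp i j k x : overlap i j x -> overlap i k x ->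
  'J (transition i k) x =
  'J (transition i j) x *m 'J (transition j k) (transition i j x).
Proof.
move=> ijx ikx; have jkx : overlap j k (transition i j x).
  apply/overlapP; rewrite param_transition //.
  by move/overlapP : ijx => [? ?]; move/overlapP : ikx => [? ?]; split=> //;
    exact: chart_image_coord.
apply/matrixP => a b; rewrite transition_jacobianE // mxE.
have -> : \sum_c 'J (transition i j) x a c *
                'J (transition j k) (transition i j x) c b =
          \sum_c pderiv a (fun y => transition i j y 0 c) x *
                 pderiv c (fun y => transition j k y 0 b) (transition i j x).
  by apply: eq_bigr => c _; congr (_ * _); exact: transition_jacobianE.
rewrite -(pderiv_comp (f := fun y => transition j k y 0 b)); last 2 first.
- by move=> c; exact: transition_differentiable.
- exact: transition_differentiable.
apply: near_pderiv; apply: filterS (near_overlap ijx) => y ijy.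
by rewrite [in LHS]/transition /= -(param_transition ijy).
Qed.

Lemma jacobian_transition_id i x : chart_image i x -> 'J (transition i i) x =
  1%:M.
Proof.
move=> ix; have iix : overlap i i x by apply/overlapP; split=> //;
  exact: dom_param.
apply/matrixP => a b; rewrite transition_jacobianE // mxE -(pderiv_coord _ _ x).
apply: near_pderiv; apply: filterS (near_overlap iix) => y /overlapP[iy _].
by rewrite /transition /= paramK.
Qed.

Lemma pderiv_transition i j (f : T -> R) x a : smooth_fun A f ->
  overlap i j x ->
  pderiv a (f \o param i) x = \sum_b 'J (transition i j) x a b *
     pderiv b (f \o param j) (transition i j x).
Proof.
move=> sf ijx; have -> : \sum_b 'J (transition i j) x a b *
                pderiv b (f \o param j) (transition i j x) =
          \sum_b pderiv a (fun y => transition i j y 0 b) x *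
                 pderiv b (f \o param j) (transition i j x).
  by apply: eq_bigr => b _; congr (_ * _); exact: transition_jacobianE.
rewrite -pderiv_comp; last 2 first.
- by move=> c; exact: transition_differentiable.
- apply: (smooth_on_differentiable (sf j)).
  by move/overlapP : ijx => [_ ?]; exact: chart_image_coord.
apply: near_pderiv; apply: filterS (near_overlap ijx) => y ijy.
by rewrite /= param_transition.
Qed.
End SmoothAtlas.

(** * Global functions with prescribed differential *)
Section Extension.
Context {R : realType} {n : nat} {M : topologicalType} (A : atlas R n M).
Hypothesis hM : smooth_manifold A.

Let hA : smooth_atlas A. Proof. by case: hM. Qed.

(** A compact subset of a Hausdorff space is closed. *)
Lemma closed_param_image (i : chart_index A) x (r : R) :
  closed_ball_ Num.Def.normr x r `<=` chart_image i ->
    closed (param i @` closed_ball_ Num.Def.normr x r).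
Proof.
move=> sub; have [hH _ _ hc] := hM; have [_ _ cp] := hc i.
apply: compact_closed => //; apply: continuous_compact.
  apply: continuous_in_subspaceT => y /set_mem yB; exact/cp/sub.
apply: bounded_closed_compact; last exact: closed_closed_ball_.
exists (`|x| + r); split; first exact: num_real.
move=> s rs y; rewrite /closed_ball_ /= => xy; apply/ltW/(le_lt_trans _ rs).
by rewrite -[y](subKr x); apply: le_trans (ler_normB _ _) _; rewrite lerD2l.
Qed.

Definition extend_by_zero (i : chart_index A) (h : 'rV[R]_n -> R) (q : M) : R :=
  if `[< dom i q >] then h (coord i q) else 0.

Lemma extend_by_zeroE (i : chart_index A) h x :
  chart_image i x -> extend_by_zero i h (param i x) = h x.
Proof.
move=> ix; rewrite /extend_by_zero (paramK hA) // ifT //; apply/asboolP.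
by case: ix => p ip <-; rewrite (coordK hA).
Qed.

(** Seen from another chart [j], the extension is [h] composed with a transition
    map on the overlap with [i], and zero on the complement of the image [K] of
    the ball, which is open.  These two open sets cover the chart, because [K]
    lies in the domain of [i]. *)
Lemma extend_by_zero_smooth (i : chart_index A) (h : 'rV[R]_n -> R) x0 r :
  closed_ball_ Num.Def.normr x0 r `<=` chart_image i ->
  (forall x, h x != 0 -> closed_ball_ Num.Def.normr x0 r x) ->
  smooth_on (chart_image i) h -> smooth_fun A (extend_by_zero i h).
Proof.
move=> sub supp sh j; have [_ _ [_ _ oA sA] hc] := hM.
apply: smooth_on_cover => x jx; have [ip|nip] := pselect (dom i (param j x)).
  exists (overlap j i).
    by case: jx ip => q jq <-; rewrite (coordK hA) // => iq; exists q.
  apply: (@smooth_on_congr _ _ _ (h \o transition j i)) => //.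
    move=> y [q [jq iq] <-]; rewrite /extend_by_zero /= /transition /=
      (coordK hA) //.
    by rewrite ifT //; exact/asboolP.
  apply: (smooth_on_comp (V := chart_image i)) => //;
    first exact: (open_chart_image hA).
  by move=> y [q [jq iq] <-]; rewrite /transition /= (coordK hA) //; exists q.
set K := param i @` closed_ball_ Num.Def.normr x0 r.
have Kdom q : K q -> dom i q.
  by case=> y /sub[p ip <-] <-; rewrite (coordK hA).
exists (chart_image j `&` (param j @^-1` (~` K))).
  by split=> // /Kdom.
apply: (@smooth_on_congr _ _ _ (fun=> 0)).
- rewrite openE => y [jy Ky]; apply: filterI.
    by apply: open_nbhs_nbhs; split=> //; exact: (open_chart_image hA).
  have [_ _ /(_ y jy)] := hc j; apply; apply: open_nbhs_nbhs; split=> //.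
  by rewrite openC; exact: closed_param_image.
- move=> y [_ Ky]; rewrite /extend_by_zero /=; case: ifP => // /asboolP iy.
  apply/esym/eqP/negPn/negP => /supp yB; apply: Ky.
  by exists (coord i (param j y)) => //; rewrite (coordK hA).
- exact: smooth_on_cst.
Qed.

(** The function is the coordinate [b], centred at [x], times a bump function.
    The derivative of the bump function drops out at [x], where the centred
    coordinate vanishes, and [k] is the value of the bump function. *)
Lemma smooth_fun_with_pderiv (i : chart_index A) x (b : 'I_n) :
  chart_image i x ->
  exists f, smooth_fun A f /\ exists2 k : R, k != 0 &
    forall a, pderiv a (f \o param i) x = k * (a == b)%:R.
Proof.
move=> ix; have oi : open (chart_image i) by exact: (open_chart_image hA).
have /nbhs_closedballP[r sub] : nbhs x (chart_image i) by exact: open_nbhs_nbhs.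
have {}sub : closed_ball_ Num.Def.normr x r%:num `<=` chart_image i.
  by move=> y xy; apply: sub; rewrite closed_ballE.
pose h y := bump x r%:num y * (y 0 b - x 0 b).
have sb : smooth_on (chart_image i) (bump x r%:num) by exact: bump_smooth.
have sl : smooth_on (chart_image i) (fun y => y 0 b - x 0 b).
  by apply: smooth_onB => //; [exact: smooth_on_coord|exact: smooth_on_cst].
exists (extend_by_zero i h); split.
  apply: (@extend_by_zero_smooth _ _ x r%:num) => //; last exact: smooth_onM.
  move=> y; rewrite mulf_eq0 negb_or => /andP[/bump_support + _].
  by apply.
exists (bump x r%:num x); first by rewrite gt_eqF // bump_center.
move=> a; rewrite (@near_pderiv _ _ _ _ h); last first.
  by apply: filterS (open_nbhs_nbhs (conj oi ix)) => y; exact: extend_by_zeroE.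
rewrite pderivM; try exact: smooth_on_differentiable ix.
rewrite subrr mulr0 add0r pderivD; last 2 first.
- exact: differentiable_coord.
- exact: differentiable_cst.
by rewrite pderiv_coord pderiv_cst addr0.
Qed.
End Extension.

(** * Directional derivatives as derivations *)
Section Derivations.
Context {R : realType} {n : nat}.
Implicit Types (f g : 'rV[R]_n -> R) (x u v : 'rV[R]_n).

Definition derivation (v : 'rV[R]_n) (f : 'rV[R]_n -> R) x : R :=
  \sum_d v 0 d * pderiv d f x.

Lemma derivationD u v f x : derivation (u + v) f x =
  derivation u f x + derivation v f x.
Proof. by rewrite /derivation -big_split; apply: eq_bigr => d _;
  rewrite mxE mulrDl. Qed.

Lemma derivationZ k v f x : derivation (k *: v) f x = k * derivation v f x.
Proof. by rewrite /derivation big_distrr; apply: eq_bigr => d _ /=;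
  rewrite mxE mulrA. Qed.

Lemma derivation_addf v f g x : differentiable f x -> differentiable g x ->
  derivation v (fun y => f y + g y) x = derivation v f x + derivation v g x.
Proof.
move=> df dg; rewrite /derivation -big_split; apply: eq_bigr => d _.
by rewrite pderivD // mulrDr.
Qed.

Lemma derivation_oppf v f x : differentiable f x ->
  derivation v (fun y => - f y) x = - derivation v f x.
Proof.
move=> df; rewrite /derivation -sumrN; apply: eq_bigr => d _.
by rewrite pderivN // mulrN.
Qed.

Lemma derivation_mulf v f g x : differentiable f x -> differentiable g x ->
  derivation v (fun y => f y * g y) x =
  derivation v f x * g x + f x * derivation v g x.
Proof.
move=> df dg; rewrite /derivation big_distrl big_distrr -big_split.
apply: eq_bigr => d _ /=; rewrite pderivM // mulrDr mulrA; congr (_ + _).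
exact: mulrCA.
Qed.

Lemma near_derivation v f g x : (\near x, f x = g x) ->
  derivation v f x = derivation v g x.
Proof. by move=> fg; apply: eq_bigr => d _; rewrite (near_pderiv d fg). Qed.

Lemma derivation_cst v (k : R) x : derivation v (fun=> k) x = 0.
Proof. by apply: big1 => d _; rewrite pderiv_cst mulr0. Qed.

Lemma derivation_sumf v m (f : 'I_m -> 'rV[R]_n -> R) x :
  (forall i, differentiable (f i) x) ->
  derivation v (fun y => \sum_i f i y) x = \sum_i derivation v (f i) x.
Proof.
move=> df; rewrite /derivation exchange_big; apply: eq_bigr => d _.
by rewrite pderiv_sum // big_distrr.
Qed.

Lemma derivation_smooth (U : set 'rV[R]_n) (V : 'rV[R]_n -> 'rV[R]_n) f :
  open U ->
  (forall a, smooth_on U (fun x => V x 0 a)) -> smooth_on U f ->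
  smooth_on U (fun x => derivation (V x) f x).
Proof.
move=> oU sV sf; apply: smooth_on_sum => // d.
by apply: smooth_onM => //; exact: smooth_on_pderiv.
Qed.

Definition derivation_mx v p q (F : 'rV[R]_n -> 'M[R]_(p, q)) x :
  'M[R]_(p, q) :=
  \matrix_(a, b) derivation v (fun y => F y a b) x.

Lemma near_derivation_mx v p q (F G : 'rV[R]_n -> 'M[R]_(p, q)) x :
  (\near x, F x = G x) -> derivation_mx v F x = derivation_mx v G x.
Proof.
move=> FG; apply/matrixP => a b; rewrite !mxE; apply: near_derivation.
by apply: filterS FG => y ->.
Qed.

Lemma derivation_mulmx v p q r (F : 'rV[R]_n -> 'M[R]_(p, q))
    (G : 'rV[R]_n -> 'M[R]_(q, r)) x :
  (forall a b, differentiable (fun y => F y a b) x) ->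
  (forall a b, differentiable (fun y => G y a b) x) ->
  derivation_mx v (fun y => F y *m G y) x =
  derivation_mx v F x *m G x + F x *m derivation_mx v G x.
Proof.
move=> dF dG; apply/matrixP => a b; rewrite !mxE -big_split.
have -> : (fun y => (F y *m G y) a b) = (fun y => \sum_k F y a k * G y k b).
  by apply/funext => y; rewrite mxE.
rewrite derivation_sumf; last by move=> k; exact: differentiable_funM.
by apply: eq_bigr => k _; rewrite /= derivation_mulf // !mxE.
Qed.

Lemma derivation_trmx v p q (F : 'rV[R]_n -> 'M[R]_(p, q)) x :
  derivation_mx v (fun y => (F y)^T) x = (derivation_mx v F x)^T.
Proof.
apply/matrixP => a b; rewrite !mxE; congr (derivation v _ x).
by apply/funext => y; rewrite mxE.
Qed.

End Derivations.

Lemma derivation_comp {R : realType} {n : nat} m (F : 'rV[R]_n -> 'rV[R]_m)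
  (f : 'rV[R]_m -> R) v x :
  (forall b, differentiable (fun y => F y 0 b) x) -> differentiable f (F x) ->
  derivation v (f \o F) x = derivation (v *m 'J F x) f (F x).
Proof.
move=> dF df; rewrite /derivation.
under eq_bigr => d _ do rewrite (pderiv_comp d dF df) big_distrr /=.
rewrite exchange_big; apply: eq_bigr => b _ /=.
rewrite mxE big_distrl; apply: eq_bigr => d _ /=.
by rewrite jacobianE // mulrA.
Qed.

(** * The Jacobi sum in coordinates *)
Section LocalPoisson.
Context {R : realType} {n : nat}.
Implicit Types (f g h u : 'rV[R]_n -> R) (x : 'rV[R]_n) (P : 'rV[R]_n ->
  'M[R]_n).

Definition gradient f x : 'rV[R]_n := \row_a pderiv a f x.

Definition hessian f x : 'M[R]_n := \matrix_(a, b) pderiv a (pderiv b f) x.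

Definition local_bracket P f g x : R :=
  \sum_a \sum_b P x a b * pderiv a f x * pderiv b g x.

(** The iterated bracket [{x^a, {x^b, x^c}}] of coordinate functions. *)
Definition hamiltonian_term P x a b c : R :=
  derivation (row a (P x)) (fun y => P y b c) x.

(** The Jacobi sum of three coordinate functions, that is, a component of the
    Schouten bracket of [P] with itself up to a constant factor. *)
Definition jacobiator P x a b c : R :=
  hamiltonian_term P x a b c + hamiltonian_term P x b c a
  + hamiltonian_term P x c a b.

Lemma local_bracketE P f g x :
  local_bracket P f g x = (gradient f x *m P x *m (gradient g x)^T) 0 0.
Proof.
rewrite /local_bracket mxE exchange_big; apply: eq_bigr => b _.
rewrite !mxE big_distrl; apply: eq_bigr => a _.
by rewrite !mxE mulrAC mulrC mulrA [_ * P x a b]mulrC.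
Qed.

Lemma near_local_bracket P f f' g g' x :
  (\near x, f x = f' x) -> (\near x, g x = g' x) ->
  local_bracket P f g x = local_bracket P f' g' x.
Proof.
move=> ff gg; apply: eq_bigr => a _; apply: eq_bigr => b _.
by rewrite (near_pderiv a ff) (near_pderiv b gg).
Qed.

Lemma sum_rotate (F : 'I_n -> 'I_n -> 'I_n -> R) :
  \sum_a \sum_b \sum_c F a b c = \sum_a \sum_b \sum_c F b c a.
Proof.
rewrite [RHS]exchange_big; apply: eq_bigr => a _.
by rewrite [RHS]exchange_big.
Qed.

Lemma mx11_trmx (m : 'M[R]_1) : m^T 0 0 = m 0 0. Proof. by rewrite mxE. Qed.

Lemma quad_expand (u w v : 'rV[R]_n) (p H K : 'M[R]_n) (d : 'cV[R]_n) :
  (u *m p *m (d + H *m p *m w^T + K *m - p *m v^T)) 0 0 =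
  (u *m p *m d) 0 0 + (u *m p *m H *m p *m w^T) 0 0
  - (u *m p *m K *m p *m v^T) 0 0.
Proof. by rewrite mulmxN mulNmx !mulmxDr mulmxN !mulmxA !mxE. Qed.

(** The transpose of a one by one matrix is itself, and the two signs from the
    antisymmetric factors cancel. *)
Lemma quad_transpose (u w : 'rV[R]_n) (p H : 'M[R]_n) :
  p^T = - p -> H^T = H ->
  (w *m p *m H *m p *m u^T) 0 0 = (u *m p *m H *m p *m w^T) 0 0.
Proof.
move=> aP sH; rewrite -[RHS]mx11_trmx !trmx_mul trmxK aP sH.
by rewrite !(mulNmx, mulmxN) opprK !mulmxA.
Qed.

(** Expanding [{f, {g, h}}] gives a term with derivatives of [P] and two terms
    with second derivatives, of [g] and of [h], which are the forms [S] below.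
    As hessians are symmetric and [P] is antisymmetric, [S u v w = S w v u], and
    the six terms of this kind in the cyclic sum cancel in pairs. *)
Lemma jacobi_local_bracket (U : set 'rV[R]_n) P f g h x :
  open U -> U x -> (P x)^T = - P x ->
  (forall a b, smooth_on U (fun y => P y a b)) ->
  smooth_on U f -> smooth_on U g -> smooth_on U h ->
  local_bracket P f (local_bracket P g h) x
  + local_bracket P g (local_bracket P h f) x
  + local_bracket P h (local_bracket P f g) x =
  \sum_a \sum_b \sum_c
    jacobiator P x a b c * pderiv a f x * pderiv b g x * pderiv c h x.
Proof.
move=> oU Ux aP sP sf sg sh.
have dP a b : differentiable (fun y => P y a b) x
  by exact: smooth_on_differentiable Ux.
pose F1 u v w := \sum_a \sum_b \sum_c hamiltonian_term P x a b c *
   pderiv a u x * pderiv b v x * pderiv c w x.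
pose S u v w := (gradient u x *m P x *m hessian v x *m P x *m (gradient w x)^T)
  0 0.
have expand u v w : smooth_on U v -> smooth_on U w ->
    local_bracket P u (local_bracket P v w) x = F1 u v w + S u v w - S u w v.
  move=> sv sw.
  have dv a : differentiable (pderiv a v) x.
    by apply: (smooth_on_differentiable (U := U)) => //;
      exact: smooth_on_pderiv.
  have dw a : differentiable (pderiv a w) x.
    by apply: (smooth_on_differentiable (U := U)) => //;
      exact: smooth_on_pderiv.
  have D d : pderiv d (local_bracket P v w) x =
      (\sum_b \sum_c pderiv d (fun y => P y b c) x * pderiv b v x *
        pderiv c w x)
      + (hessian v x *m P x *m (gradient w x)^T) d 0
      + (hessian w x *m (P x)^T *m (gradient v x)^T) d 0.
    rewrite /local_bracket pderiv_sum; last first.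
      move=> a; apply: differentiable_funsum => b.
      exact: differentiable_funM (differentiable_funM (dP _ _) (dv _)) (dw _).
    have -> : (hessian v x *m P x *m (gradient w x)^T) d 0 =
      \sum_b \sum_c P x b c * pderiv d (pderiv b v) x * pderiv c w x.
      rewrite mxE exchange_big; apply: eq_bigr => c _.
      rewrite !mxE big_distrl; apply: eq_bigr => b _.
      by rewrite /= /hessian /gradient !mxE; ring.
    have -> : (hessian w x *m (P x)^T *m (gradient v x)^T) d 0 =
      \sum_b \sum_c P x b c * pderiv b v x * pderiv d (pderiv c w) x.
      rewrite mxE; apply: eq_bigr => b _.
      rewrite !mxE big_distrl; apply: eq_bigr => c _.
      by rewrite /= /hessian /gradient !mxE; ring.
    rewrite -!big_split; apply: eq_bigr => b _ /=.
    rewrite pderiv_sum; last first.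
      move=> c.
      exact: differentiable_funM (differentiable_funM (dP _ _) (dv _)) (dw _).
    rewrite -!big_split; apply: eq_bigr => c _ /=.
    rewrite (pderivM d (differentiable_funM (dP b c) (dv b)) (dw c)).
    rewrite (pderivM d (dP b c) (dv b)).
    move: (pderiv d (pderiv b v) x) (pderiv d (pderiv c w) x) (pderiv b v x).
    move: (pderiv c w x) => q1 q2 q3 q4.
    ring.
  have gradE : (gradient (local_bracket P v w) x)^T =
      (\col_d \sum_b \sum_c pderiv d (fun y => P y b c) x * pderiv b v x *
        pderiv c w x)
      + hessian v x *m P x *m (gradient w x)^T
      + hessian w x *m (P x)^T *m (gradient v x)^T.
    by apply/matrixP => d k; rewrite (ord1 k) [LHS]mxE [LHS]mxE D !mxE.
  rewrite local_bracketE gradE aP /S quad_expand; congr (_ + _ - _).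
  rewrite mxE; under eq_bigr do rewrite [X in _ * X]mxE mxE.
  rewrite /F1.
  transitivity (\sum_d \sum_a \sum_b \sum_c pderiv a u x * P x a d *
      (pderiv d (fun y => P y b c) x * pderiv b v x * pderiv c w x)).
    apply: eq_bigr => d _; rewrite big_distrl; apply: eq_bigr => a _.
    by rewrite !mxE big_distrr; apply: eq_bigr => b _; rewrite big_distrr.
  rewrite exchange_big; apply: eq_bigr => a _.
  rewrite exchange_big; apply: eq_bigr => b _.
  rewrite exchange_big; apply: eq_bigr => c _.
  rewrite /hamiltonian_term /derivation !big_distrl; apply: eq_bigr => d _ /=.
  by rewrite mxE; ring.
have symS u v w : smooth_on U v -> S w v u = S u v w.
  move=> sv; apply: quad_transpose => //.
  by apply/matrixP => a b; rewrite !mxE; exact: pderivC Ux.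
rewrite !expand // (symS f g h) // (symS g h f) // (symS h f g) //.
have cancel (p q r s t u : R) :
  p + s - t + (q + t - u) + (r + u - s) = p + q + r by ring.
have rot (k p q r : R) : k * q * r * p = k * p * q * r by ring.
rewrite cancel.
have -> : F1 g h f = \sum_a \sum_b \sum_c hamiltonian_term P x b c a *
   pderiv a f x * pderiv b g x * pderiv c h x.
  rewrite /F1 sum_rotate; do 3 (apply: eq_bigr => ? _); exact: rot.
have -> : F1 h f g = \sum_a \sum_b \sum_c hamiltonian_term P x c a b *
   pderiv a f x * pderiv b g x * pderiv c h x.
  rewrite /F1 sum_rotate sum_rotate; do 3 (apply: eq_bigr => ? _).
  exact/esym/rot.
rewrite /F1 -!big_split; apply: eq_bigr => a _ /=.
rewrite -!big_split; apply: eq_bigr => b _ /=.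
by rewrite -!big_split; apply: eq_bigr => c _ /=; rewrite -!mulrDl.
Qed.

End LocalPoisson.

(** * Poisson tensors in charts *)
Section PoissonAtlas.
Context {R : realType} {n : nat} {T : Type} (A : atlas R n T).
Hypothesis hA : smooth_atlas A.
Implicit Types (P : components A 'M[R]_n) (i : chart_index A) (x : 'rV[R]_n).

Lemma gradient_transition i j (f : T -> R) x : smooth_fun A f ->
  overlap i j x ->
  gradient (f \o param i) x =
  gradient (f \o param j) (transition i j x) *m ('J (transition i j) x)^T.
Proof.
move=> sf ijx; apply/rowP => a;
  rewrite [LHS]mxE (pderiv_transition hA _ sf ijx).
rewrite [RHS]mxE; apply: eq_bigr => b _; rewrite mulrC [X in _ = X * _]mxE.
by rewrite [X in _ = _ * X]mxE.
Qed.

(** The transformation laws of [P] and of the two differentials compensate each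
    other, so that any chart around a point computes the bracket. *)
Lemma bracket_param P (f g : T -> R) i x : is_bivector_field P ->
  smooth_fun A f -> smooth_fun A g -> chart_image i x ->
  bracket P f g (param i x) =
  local_bracket (P i) (f \o param i) (g \o param i) x.
Proof.
move=> [_ _ tP] sf sg ix; set k := chart_at A (param i x).
have kx : overlap i k x.
  by apply/(overlapP hA); split=> //; have [+ _ _ _] := hA; apply.
rewrite -[LHS]/(local_bracket (P k) (f \o param k) (g \o param k)
  (transition i k x)).
rewrite !local_bracketE (gradient_transition sf kx) (gradient_transition sg kx).
by rewrite (tP i k x kx) trmx_mul trmxK !mulmxA.
Qed.

Lemma local_bracket_smooth (U : set 'rV[R]_n) (Q : 'rV[R]_n -> 'M[R]_n) f g :
  open U -> (forall a b, smooth_on U (fun x => Q x a b)) ->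
  smooth_on U f -> smooth_on U g -> smooth_on U (local_bracket Q f g).
Proof.
move=> oU sQ sf sg; do 2 (apply: smooth_on_sum => // ?).
by apply: smooth_onM => //; [apply: smooth_onM|]=> //; exact: smooth_on_pderiv.
Qed.

Lemma bracket_smooth P (f g : T -> R) : is_bivector_field P ->
  smooth_fun A f -> smooth_fun A g -> smooth_fun A (bracket P f g).
Proof.
move=> bP sf sg i; have oi := @open_chart_image _ _ _ _ hA i.
apply: (smooth_on_congr (f :=
  local_bracket (P i) (f \o param i) (g \o param i))) => //.
  by move=> x ix; rewrite /= (bracket_param bP sf sg ix).
by apply: local_bracket_smooth => //; have [+ _ _] := bP; apply.
Qed.

Lemma jacobi_param P (f g h : T -> R) i x : is_bivector_field P ->
  smooth_fun A f -> smooth_fun A g -> smooth_fun A h -> chart_image i x ->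
  bracket P f (bracket P g h) (param i x) +
    bracket P g (bracket P h f) (param i x)
    + bracket P h (bracket P f g) (param i x) =
  \sum_a \sum_b \sum_c jacobiator (P i) x a b c * pderiv a (f \o param i) x *
     pderiv b (g \o param i) x * pderiv c (h \o param i) x.
Proof.
move=> bP sf sg sh ix; have oi := @open_chart_image _ _ _ _ hA i.
have ext u v w : smooth_fun A u -> smooth_fun A v -> smooth_fun A w ->
    bracket P u (bracket P v w) (param i x) = local_bracket (P i) (u \o param i)
      (local_bracket (P i) (v \o param i) (w \o param i)) x.
  move=> su sv sw; rewrite (bracket_param bP su (bracket_smooth bP sv sw) ix).
  apply: near_local_bracket; first by near=> y.
  apply: filterS (open_nbhs_nbhs (conj oi ix)) => y iy.
  by rewrite /= (bracket_param bP sv sw iy).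
rewrite !ext //; apply: (jacobi_local_bracket (U := chart_image i)) => //.
  by have [_ + _] := bP; apply.
by have [+ _ _] := bP; apply.
Unshelve. all: by end_near. Qed.

Lemma is_poisson_of_jacobiator P : is_bivector_field P ->
  (forall i x, chart_image i x -> forall a b c, jacobiator (P i) x a b c = 0) ->
  is_poisson P.
Proof.
move=> bP J0; split=> // f g h sf sg sh p; set i := chart_at A p.
have ip : dom i p by have [+ _ _ _] := hA; apply.
rewrite -(coordK hA ip) (jacobi_param bP sf sg sh) //;
  last exact: chart_image_coord.
do 3 (rewrite big1 // => ? _); rewrite J0 ?mul0r //; exact: chart_image_coord.
Qed.

End PoissonAtlas.

Section PoissonManifold.
Context {R : realType} {n : nat} {M : topologicalType} (A : atlas R n M).
Hypothesis hM : smooth_manifold A.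
Implicit Types (P : components A 'M[R]_n) (i : chart_index A) (x : 'rV[R]_n).
Let hA : smooth_atlas A. Proof. by case: hM. Qed.

Lemma sum_delta (F : 'I_n -> R) (k : R) b :
  \sum_a F a * (k * (a == b)%:R) = F b * k.
Proof.
rewrite (bigD1 b) //= eqxx mulr1 big1 ?addr0 // => a /negbTE ->.
by rewrite mulr0 mulr0.
Qed.

(** The Jacobi identity is tested on three global functions whose differentials
    at [x] are nonzero multiples of those of the coordinates [a], [b], [c]. *)
Lemma poisson_jacobiator P i x a b c : is_poisson P -> chart_image i x ->
  jacobiator (P i) x a b c = 0.
Proof.
move=> [bP jP] ix.
have [f [sf [kf kf0 Df]]] := smooth_fun_with_pderiv hM a ix.
have [g [sg [kg kg0 Dg]]] := smooth_fun_with_pderiv hM b ix.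
have [h [sh [kh kh0 Dh]]] := smooth_fun_with_pderiv hM c ix.
have := jP f g h sf sg sh (param i x); rewrite (jacobi_param hA bP) //.
under eq_bigr do under eq_bigr do under eq_bigr do rewrite Df Dg Dh.
under eq_bigr do under eq_bigr do rewrite sum_delta mulrAC.
under eq_bigr do rewrite sum_delta mulrAC.
rewrite -!big_distrl /= sum_delta => /eqP.
by rewrite !mulf_eq0 (negbTE kf0) (negbTE kg0) (negbTE kh0) !orbF => /eqP.
Qed.

(** The Casimir condition is tested on a global function whose differential at
    [x] is a nonzero multiple of that of the coordinate [a]. *)
Lemma casimir_pderiv P i x a (c : M -> R) : is_bivector_field P ->
  is_casimir P c ->
  chart_image i x -> derivation (row a (P i x)) (c \o param i) x = 0.
Proof.
move=> bP [sc cP] ix; have [f [sf [k k0 Df]]] := smooth_fun_with_pderiv hM a ix.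
have := cP f sf (param i x); rewrite (bracket_param hA bP) //.
rewrite /local_bracket exchange_big /=.
under eq_bigr do under eq_bigr do rewrite Df mulrAC.
under eq_bigr do rewrite sum_delta.
rewrite -big_distrl => /eqP; rewrite mulf_eq0 (negbTE k0) orbF => /eqP <-.
by apply: eq_bigr => d _; rewrite mxE.
Qed.
End PoissonManifold.

(** * Deformation along commuting Poisson vector fields *)
Section Deformation.
Context {R : realType} {n : nat}.
Implicit Types (f g : 'rV[R]_n -> R) (x u v w : 'rV[R]_n).

Lemma wedgeE (u v : 'rV[R]_n) a b : wedge u v a b =
  u 0 a * v 0 b - v 0 a * u 0 b.
Proof. by rewrite !mxE !big_ord1 !mxE. Qed.

Lemma wedge_trmx (u v : 'rV[R]_n) : (wedge u v)^T = - wedge u v.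
Proof. by apply/matrixP => a b; rewrite mxE [RHS]mxE !wedgeE; ring. Qed.

Lemma wedge_mulmx (u v : 'rV[R]_n) m (J : 'M[R]_(n, m)) :
  wedge (u *m J) (v *m J) = J^T *m wedge u v *m J.
Proof. by rewrite /wedge !trmx_mul mulmxBr mulmxBl !mulmxA. Qed.

(** The algebraic core of the deformation theorem.  Here [z], [w] are the
    components of [Z], [W]; [zz a], [ww a] stand for [Z(Z^a)], [W(W^a)], and
    [zw a] for the common value of [Z(W^a)] and [W(Z^a)]; [pz a b], [pw a b] are
    the derivatives of [Z^b], [W^b] along the row [a] of [P]; [zg], [wg] are the
    derivatives of the factor [g]; and [k a b c] is [{x^a, {x^b, x^c}}] for [P].
    Then [E a b c] is the same iterated bracket for [P + g Z /\ W], once the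
    derivatives of [P] along [Z] and [W] are expressed by [pz] and [pw]. *)
Lemma deformation_identity (z w zz ww zw : 'I_n -> R)
    (pz pw : 'I_n -> 'I_n -> R) (g zg wg : R) (k : 'I_n -> 'I_n -> 'I_n -> R) a b c :
  let E a b c := k a b c
    + g * (pz a b * w c + z b * pw a c - pw a b * z c - w b * pz a c)
    + g * z a * (pw b c - pw c b + wg * (z b * w c - w b * z c)
       + g * (zw b * w c + z b * ww c - ww b * z c - w b * zw c))
    - g * w a * (pz b c - pz c b + zg * (z b * w c - w b * z c)
       + g * (zz b * w c + z b * zw c - zw b * z c - w b * zz c)) in
  k a b c + k b c a + k c a b = 0 -> E a b c + E b c a + E c a b = 0.
Proof. by move=> E kE; rewrite -kE /E; ring. Qed.

(** The row [u] of the deformed matrix is the row [u] of [P] plus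
    [g Z^u W - g W^u Z].  Differentiating the deformed components along it by the
    Leibniz rule brings the iterated bracket into the form of
    [deformation_identity]. *)
Lemma jacobiator_deform (P : 'rV[R]_n -> 'M[R]_n) (Z W : 'rV[R]_n -> 'rV[R]_n)
    (g : 'rV[R]_n -> R) x :
  (forall a b, differentiable (fun y => P y a b) x) ->
  (forall a, differentiable (fun y => Z y 0 a) x) ->
  (forall a, differentiable (fun y => W y 0 a) x) ->
  differentiable g x -> (P x)^T = - P x ->
  (forall a b c, jacobiator P x a b c = 0) ->
  (forall a, derivation (row a (P x)) g x = 0) ->
  (forall a b, derivation (Z x) (fun y => P y a b) x =
     derivation (row a (P x)) (fun y => Z y 0 b) x -
     derivation (row b (P x)) (fun y => Z y 0 a) x) ->
  (forall a b, derivation (W x) (fun y => P y a b) x =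
     derivation (row a (P x)) (fun y => W y 0 b) x -
     derivation (row b (P x)) (fun y => W y 0 a) x) ->
  (forall a, derivation (Z x) (fun y => W y 0 a) x =
             derivation (W x) (fun y => Z y 0 a) x) ->
  forall a b c, jacobiator (fun y => P y + g y *: wedge (Z y) (W y)) x a b c =
    0.
Proof.
move=> dP dZ dW dg aP JP gP ZP WP ZW a b c.
pose Q y := P y + g y *: wedge (Z y) (W y).
have derQ v (p q : 'I_n) : derivation v (fun y => Q y p q) x =
   derivation v (fun y => P y p q) x
   + (derivation v g x * (Z x 0 p * W x 0 q - W x 0 p * Z x 0 q)
   + g x * (derivation v (fun y => Z y 0 p) x * W x 0 q
          + Z x 0 p * derivation v (fun y => W y 0 q) x
          - (derivation v (fun y => W y 0 p) x * Z x 0 q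
          + W x 0 p * derivation v (fun y => Z y 0 q) x))).
  have -> : (fun y => Q y p q) = (fun y => P y p q
      + g y * (Z y 0 p * W y 0 q + - (W y 0 p * Z y 0 q))).
    by apply/funext => y; rewrite /Q mxE [X in _ + X]mxE wedgeE.
  have d1 := differentiable_funM (dZ p) (dW q).
  have d2 := differentiable_funM (dW p) (dZ q).
  have d3 := differentiable_funD d1 (differentiable_funN d2).
  rewrite (derivation_addf _ (dP p q) (differentiable_funM dg d3)).
  rewrite (derivation_mulf _ dg d3)
    (derivation_addf _ d1 (differentiable_funN d2)).
  by rewrite (derivation_oppf _ d2) (derivation_mulf _ (dZ p) (dW q))
     (derivation_mulf _ (dW p) (dZ q)).
have rowQ (u : 'I_n) : row u (Q x) = row u (P x) + (g x * Z x 0 u) *: W x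
                            + (- (g x * W x 0 u)) *: Z x.
  by apply/rowP => d; rewrite [LHS]mxE /Q mxE [X in _ + X]mxE wedgeE !mxE; ring.
pose D v f := derivation v f x.
have ham (u v w : 'I_n) : hamiltonian_term Q x u v w =
  hamiltonian_term P x u v w
    + g x * (D (row u (P x)) (fun y => Z y 0 v) * W x 0 w
             + Z x 0 v * D (row u (P x)) (fun y => W y 0 w)
             - D (row u (P x)) (fun y => W y 0 v) * Z x 0 w
             - W x 0 v * D (row u (P x)) (fun y => Z y 0 w))
    + g x * Z x 0 u * (D (row v (P x)) (fun y => W y 0 w)
             - D (row w (P x)) (fun y => W y 0 v)
             + D (W x) g * (Z x 0 v * W x 0 w - W x 0 v * Z x 0 w)
       + g x * (D (W x) (fun y => Z y 0 v) * W x 0 w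
             + Z x 0 v * D (W x) (fun y => W y 0 w)
             - D (W x) (fun y => W y 0 v) * Z x 0 w
             - W x 0 v * D (W x) (fun y => Z y 0 w)))
    - g x * W x 0 u * (D (row v (P x)) (fun y => Z y 0 w)
             - D (row w (P x)) (fun y => Z y 0 v)
             + D (Z x) g * (Z x 0 v * W x 0 w - W x 0 v * Z x 0 w)
       + g x * (D (Z x) (fun y => Z y 0 v) * W x 0 w
             + Z x 0 v * D (W x) (fun y => Z y 0 w)
             - D (W x) (fun y => Z y 0 v) * Z x 0 w
             - W x 0 v * D (Z x) (fun y => Z y 0 w))).
  rewrite /hamiltonian_term rowQ !derivationD !derivationZ !derQ gP ZP WP !ZW
    /D.
  (* The derivatives become variables, so that only their scalar values matter. *)
  repeat match goal with
  | |- context [derivation ?v ?f x] => generalize (derivation v f x)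
  end.
  by intros; ring.
rewrite /jacobiator !ham.
have := (@deformation_identity (fun u : 'I_n => Z x 0 u)
  (fun u : 'I_n => W x 0 u)
  (fun u : 'I_n => D (Z x) (fun y => Z y 0 u))
    (fun u : 'I_n => D (W x) (fun y => W y 0 u))
  (fun u : 'I_n => D (W x) (fun y => Z y 0 u))
  (fun u v : 'I_n => D (row u (P x)) (fun y => Z y 0 v))
  (fun u v : 'I_n => D (row u (P x)) (fun y => W y 0 v))
  (g x) (D (Z x) g) (D (W x) g) (hamiltonian_term P x)
  a b c (JP a b c)).
exact.
Qed.

End Deformation.

Section DeformationAtlas.
Context {R : realType} {n : nat} {T : Type} (A : atlas R n T).
Hypothesis hA : smooth_atlas A.
Implicit Types (P : components A 'M[R]_n) (Z W : components A 'rV[R]_n).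

Definition deform P (c : T -> R) Z W : components A 'M[R]_n :=
  fun i x => P i x + c (param i x) *: wedge (Z i x) (W i x).

Lemma deform_bivector P c Z W : is_bivector_field P -> smooth_fun A c ->
  is_vector_field Z -> is_vector_field W -> is_bivector_field (deform P c Z W).
Proof.
move=> [sP aP tP] sc [sZ tZ] [sW tW]; split.
- move=> i a b; have oi := @open_chart_image _ _ _ _ hA i.
  have -> : (fun x => deform P c Z W i x a b) = (fun x => P i x a b
      + (c \o param i) x * (Z i x 0 a * W i x 0 b - W i x 0 a * Z i x 0 b)).
    by apply/funext => x; rewrite mxE [X in _ + X]mxE wedgeE.
  apply: smooth_onD => //; apply: smooth_onM => //.
  by apply: smooth_onB => //; apply: smooth_onM.
- move=> i x ix; rewrite /deform linearD linearZ /= wedge_trmx aP //.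
  by rewrite scalerN opprD.
- move=> i j x ijx; rewrite /deform mulmxDr mulmxDl -scalemxAr -scalemxAl.
  by rewrite tP // tZ // tW // wedge_mulmx (param_transition hA ijx).
Qed.

(** Antisymmetry of [P] turns the contraction over the first index into one over
    a row. *)
Lemma lie_derivativeE P Z i x a b : (P i x)^T = - P i x ->
  lie_derivative Z P i x a b =
  derivation (Z i x) (fun y => P i y a b) x
  - (derivation (row a (P i x)) (fun y => Z i y 0 b) x
     - derivation (row b (P i x)) (fun y => Z i y 0 a) x).
Proof.
move=> aP; rewrite mxE /derivation -!sumrB; apply: eq_bigr => s _; rewrite !mxE.
have -> : P i x s b = - P i x b s.
  by have /matrixP/(_ b s) := aP; rewrite !mxE.
by rewrite mulNr opprB opprK addrA.
Qed.

Lemma lie_bracketE Z W i x a :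
  lie_bracket Z W i x 0 a = derivation (Z i x) (fun y => W i y 0 a) x
  - derivation (W i x) (fun y => Z i y 0 a) x.
Proof. by rewrite mxE sumrB. Qed.

Lemma poisson_vector_fieldE P Z i : is_bivector_field P ->
  is_poisson_vector_field P Z ->
  forall x, chart_image i x -> forall a b,
  derivation (Z i x) (fun y => P i y a b) x =
  derivation (row a (P i x)) (fun y => Z i y 0 b) x
  - derivation (row b (P i x)) (fun y => Z i y 0 a) x.
Proof.
move=> [_ aP _] [_ LZ] x ix a b; apply/eqP.
by rewrite -subr_eq0 -(lie_derivativeE _ _ _ (aP i x ix)) LZ // mxE.
Qed.

Lemma commute_fieldsE Z W i : commute_fields Z W ->
  forall x, chart_image i x -> forall a,
  derivation (Z i x) (fun y => W i y 0 a) x =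
  derivation (W i x) (fun y => Z i y 0 a) x.
Proof.
by move=> ZW x ix a; apply/eqP; rewrite -subr_eq0 -lie_bracketE ZW // mxE.
Qed.

Lemma deform_poisson P c Z W : is_bivector_field P ->
  (forall i x, chart_image i x -> forall a b d, jacobiator (P i) x a b d = 0) ->
  smooth_fun A c ->
  (forall i x, chart_image i x -> forall a,
     derivation (row a (P i x)) (c \o param i) x = 0) ->
  is_poisson_vector_field P Z -> is_poisson_vector_field P W ->
  commute_fields Z W -> is_poisson (deform P c Z W).
Proof.
move=> bP JP sc cP hZ hW ZW; have [vZ _] := hZ; have [vW _] := hW.
apply: (is_poisson_of_jacobiator hA); first exact: deform_bivector.
have [sP aP _] := bP; have [sZ _] := vZ; have [sW _] := vW.
move=> i x ix a b d.
apply: (jacobiator_deform (g := c \o param i)).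
- by move=> u v; exact: smooth_on_differentiable (sP i u v) ix.
- by move=> u; exact: smooth_on_differentiable (sZ i u) ix.
- by move=> u; exact: smooth_on_differentiable (sW i u) ix.
- exact: smooth_on_differentiable (sc i) ix.
- exact: aP.
- by move=> u v w; exact: JP.
- exact: cP.
- exact: poisson_vector_fieldE.
- exact: poisson_vector_fieldE.
- exact: commute_fieldsE.
Qed.

End DeformationAtlas.

(** * Lifts of functions and vector fields in coordinates *)
Section Lifts.
Context {R : realType} {N : nat}.
Implicit Types (f g : 'rV[R]_N -> R) (U : set 'rV[R]_N).
Implicit Types (z : 'rV[R]_(N + N)) (V : 'rV[R]_N -> 'rV[R]_N).

Definition tangent_set U : set 'rV[R]_(N + N) := [set z | U (lsubmx z)].

Lemma open_tangent_set U : open U -> open (tangent_set U).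
Proof. by apply: open_comp => z _; exact: continuous_lsubmx. Qed.

(** In the coordinates [z = row_mx x y] of the tangent bundle: the pullback of a
    function, its differential as a fibrewise linear function, and the vertical
    and complete lifts of a vector field. *)
Definition vlift f z : R := f (lsubmx z).
Definition clift f z : R := derivation (rsubmx z) f (lsubmx z).
Definition vfield V z : 'rV[R]_(N + N) := row_mx 0 (V (lsubmx z)).
Definition cfield V z : 'rV[R]_(N + N) :=
  row_mx (V (lsubmx z)) (derivation_mx (rsubmx z) V (lsubmx z)).

Lemma vlift_smooth U f : open U -> smooth_on U f ->
  smooth_on (tangent_set U) (vlift f).
Proof.
move=> oU; apply: smooth_on_comp => //; first exact: open_tangent_set.
by move=> b; under eq_fun do rewrite mxE; exact: smooth_on_coord.
Qed.

Lemma clift_smooth U f : open U -> smooth_on U f ->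
  smooth_on (tangent_set U) (clift f).
Proof.
move=> oU sf; have oT := open_tangent_set oU.
apply: smooth_on_sum => // s; apply: smooth_onM => //.
  by under eq_fun do rewrite mxE; exact: smooth_on_coord.
by apply: vlift_smooth => //; exact: smooth_on_pderiv.
Qed.

Lemma pderiv_lsubmx (e : 'I_(N + N)) b z :
  pderiv e (fun z => (lsubmx z : 'rV[R]_N) 0 b) z = (e == lshift N b)%:R.
Proof. by under eq_fun do rewrite mxE; exact: pderiv_coord. Qed.

Lemma pderiv_rsubmx (e : 'I_(N + N)) b z :
  pderiv e (fun z => (rsubmx z : 'rV[R]_N) 0 b) z = (e == rshift N b)%:R.
Proof. by under eq_fun do rewrite mxE; exact: pderiv_coord. Qed.

Lemma differentiable_lsubmx_coord b z :
  differentiable (fun z => (lsubmx z : 'rV[R]_N) 0 b) z.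
Proof. by under eq_fun do rewrite mxE; exact: differentiable_coord. Qed.

Lemma differentiable_rsubmx_coord b z :
  differentiable (fun z => (rsubmx z : 'rV[R]_N) 0 b) z.
Proof. by under eq_fun do rewrite mxE; exact: differentiable_coord. Qed.

Lemma differentiable_vlift f z : differentiable f (lsubmx z) ->
  differentiable (vlift f) z.
Proof.
by move=> df; apply: differentiable_comp => //; exact: differentiable_lsubmx.
Qed.

Lemma pderiv_lshift_vlift f z a : differentiable f (lsubmx z) ->
  pderiv (lshift N a) (vlift f) z = pderiv a f (lsubmx z).
Proof.
move=> df; rewrite [LHS](pderiv_comp _
  (fun b => differentiable_lsubmx_coord b z) df).
rewrite (bigD1 a) //= pderiv_lsubmx eqxx mul1r big1 ?addr0 // => b ba.
by rewrite pderiv_lsubmx (inj_eq (@lshift_inj _ _)) eq_sym (negbTE ba) mul0r.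
Qed.

Lemma pderiv_rshift_vlift f z a : differentiable f (lsubmx z) ->
  pderiv (rshift N a) (vlift f) z = 0.
Proof.
move=> df; rewrite [LHS](pderiv_comp _
  (fun b => differentiable_lsubmx_coord b z) df).
by rewrite big1 // => b _; rewrite pderiv_lsubmx eq_rlshift mul0r.
Qed.

Lemma pderiv_clift e f z U : open U -> smooth_on U f -> tangent_set U z ->
  pderiv e (clift f) z = \sum_s ((e == rshift N s)%:R * pderiv s f (lsubmx z)
     + (rsubmx z) 0 s * pderiv e (vlift (pderiv s f)) z).
Proof.
move=> oU sf Uz; have dv s : differentiable (vlift (pderiv s f)) z.
  apply: differentiable_vlift.
  exact: (smooth_on_differentiable (smooth_on_pderiv s sf) Uz).
rewrite pderiv_sum; last first.
  by move=> s; apply: differentiable_funM (dv s);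
    exact: differentiable_rsubmx_coord.
apply: eq_bigr => s _.
rewrite (pderivM e (differentiable_rsubmx_coord s z) (dv s)).
by rewrite pderiv_rsubmx.
Qed.

(** The derivative of [sum_s y^s d_s f] by [x^a] is [sum_s y^s d_a d_s f]; the
    mixed derivatives must be exchanged to see a complete lift. *)
Lemma pderiv_lshift_clift f z a U : open U -> smooth_on U f ->
  tangent_set U z ->
  pderiv (lshift N a) (clift f) z = clift (pderiv a f) z.
Proof.
move=> oU sf Uz; rewrite (pderiv_clift _ oU sf Uz); apply: eq_bigr => s _.
have ds := smooth_on_differentiable (smooth_on_pderiv s sf) Uz.
rewrite (pderiv_lshift_vlift a ds) (pderivC a s oU sf Uz) eq_lrshift.
by rewrite [_%:R * _]mul0r add0r.
Qed.

Lemma pderiv_rshift_clift f z a U : open U -> smooth_on U f ->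
  tangent_set U z ->
  pderiv (rshift N a) (clift f) z = pderiv a f (lsubmx z).
Proof.
move=> oU sf Uz; rewrite (pderiv_clift _ oU sf Uz) (bigD1 a) //= big1.
  rewrite eqxx mul1r pderiv_rshift_vlift ?mulr0 ?addr0 //.
  exact: (smooth_on_differentiable (smooth_on_pderiv a sf) Uz).
move=> s sa; rewrite (inj_eq (@rshift_inj _ _)) eq_sym (negbTE sa) mul0r add0r.
rewrite pderiv_rshift_vlift ?mulr0 //.
exact: (smooth_on_differentiable (smooth_on_pderiv s sf) Uz).
Qed.

Lemma derivation_row_mx (u v : 'rV[R]_N) (F : 'rV[R]_(N + N) -> R) z :
  derivation (row_mx u v) F z =
  \sum_a u 0 a * pderiv (lshift N a) F z + \sum_a v 0 a *
    pderiv (rshift N a) F z.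
Proof.
rewrite /derivation big_split_ord; congr (_ + _); apply: eq_bigr => a _.
  by rewrite row_mxEl.
by rewrite row_mxEr.
Qed.

Lemma vfield_vlift V f z : differentiable f (lsubmx z) ->
  derivation (vfield V z) (vlift f) z = 0.
Proof.
move=> df; rewrite derivation_row_mx [X in X + _]big1 ?add0r.
  by rewrite big1 // => a _; rewrite pderiv_rshift_vlift // mulr0.
by move=> a _; rewrite mxE mul0r.
Qed.

Lemma cfield_vlift V f z : differentiable f (lsubmx z) ->
  derivation (cfield V z) (vlift f) z = vlift (fun x => derivation (V x) f x) z.
Proof.
move=> df; rewrite derivation_row_mx [X in _ + X]big1 ?addr0.
  by apply: eq_bigr => a _; rewrite pderiv_lshift_vlift.
by move=> a _; rewrite pderiv_rshift_vlift // mulr0.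
Qed.

Lemma vfield_clift V f z U : open U -> smooth_on U f -> tangent_set U z ->
  derivation (vfield V z) (clift f) z = vlift (fun x => derivation (V x) f x) z.
Proof.
move=> oU sf Uz; rewrite derivation_row_mx [X in X + _]big1 ?add0r.
  by apply: eq_bigr => a _; rewrite (pderiv_rshift_clift _ oU sf Uz).
by move=> a _; rewrite mxE mul0r.
Qed.

(** The two kinds of coordinates contribute the two halves of the Leibniz rule
    for the derivative along [y] of the sum of the products [V^a d_a f]. *)
Lemma cfield_clift V f z U : open U -> smooth_on U f ->
  (forall a, smooth_on U (fun x => V x 0 a)) -> tangent_set U z ->
  derivation (cfield V z) (clift f) z = clift (fun x => derivation (V x) f x) z.
Proof.
move=> oU sf sV Uz; rewrite derivation_row_mx -big_split /clift.
have dV a : differentiable (fun x => V x 0 a) (lsubmx z).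
  exact: (smooth_on_differentiable (sV a) Uz).
have df a : differentiable (pderiv a f) (lsubmx z).
  exact: (smooth_on_differentiable (smooth_on_pderiv a sf) Uz).
rewrite [RHS]derivation_sumf; last by move=> a;
  exact: differentiable_funM (dV a) (df a).
apply: eq_bigr => a _.
rewrite (pderiv_lshift_clift _ oU sf Uz) (pderiv_rshift_clift _ oU sf Uz).
by rewrite (derivation_mulf _ (dV a) (df a)) addrC mxE.
Qed.

Lemma clift_eq0 U f z : open U -> (forall x, U x -> f x = 0) ->
  tangent_set U z ->
  clift f z = 0.
Proof.
move=> oU f0 Uz; rewrite -(derivation_cst (rsubmx z) 0 (lsubmx z)).
by apply: near_derivation; apply: filterS (open_nbhs_nbhs (conj oU Uz)).
Qed.

End Lifts.

(** * The atlas of the tangent bundle *)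
Section TangentAtlas.
Context {R : realType} {N : nat} {M : Type} (A : atlas R N M).
Hypothesis hA : smooth_atlas A.
Implicit Types (i j k : chart_index A) (z : 'rV[R]_(N + N)).
Local Notation TA := (tangent_atlas A).

Lemma jacobian_transitionK i j x : overlap i j x ->
  'J (transition i j) x *m 'J (transition j i) (transition i j x) = 1%:M.
Proof.
move=> ijx; have /(overlapP hA)[ix _] := ijx.
have iix : overlap i i x by apply/(overlapP hA); split=> //; exact: dom_param.
by rewrite -(jacobian_transition_comp hA ijx iix)
  (jacobian_transition_id hA ix).
Qed.

Lemma dom_chart_at p : dom (chart_at A p) p.
Proof. by have [+ _ _ _] := hA; apply. Qed.

Lemma overlap_chart_at i x : chart_image i x ->
  overlap i (chart_at A (param i x)) x.
Proof. by move=> ix; apply/(overlapP hA); split=> //; exact: dom_chart_at. Qed.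

Lemma tangent_coordK i (q : M * 'rV[R]_N) : dom i q.1 ->
  param (i : chart_index TA) (coord (i : chart_index TA) q) = q.
Proof.
case: q => p v /= ip; set k := chart_at A p; rewrite row_mxKl row_mxKr.
have kp : dom k p by exact: dom_chart_at.
have kip : overlap k i (coord k p) by exists p.
have -> : coord i p = transition k i (coord k p)
  by rewrite /transition /= (coordK hA kp).
rewrite (param_transition hA kip) (coordK hA kp); congr pair.
by rewrite -mulmxA (jacobian_transitionK kip) mulmx1.
Qed.

Lemma tangent_paramK i z : chart_image i (lsubmx z) ->
  coord (i : chart_index TA) (param (i : chart_index TA) z) = z.
Proof.
move=> ix /=; rewrite (paramK hA ix) -mulmxA.
have ikx := overlap_chart_at ix; set k := chart_at A _ in ikx *.
have -> : coord k (param i (lsubmx z)) = transition i k (lsubmx z) by [].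
by rewrite (jacobian_transitionK ikx) mulmx1 hsubmxK.
Qed.

Lemma tangent_chart_image i :
  chart_image (i : chart_index TA) = tangent_set (chart_image i).
Proof.
apply/seteqP; split=> z.
  by case=> -[p v] /= ip <-; rewrite /tangent_set /= row_mxKl; exists p.
rewrite /tangent_set /= => ix.
exists (param (i : chart_index TA) z); last exact: tangent_paramK.
exact: (dom_param hA).
Qed.

Lemma tangent_overlap i j :
  overlap (i : chart_index TA) j = tangent_set (overlap i j).
Proof.
apply/seteqP; split=> z.
  by case=> -[p v] /= [ip jp] <-; rewrite /tangent_set /= row_mxKl; exists p.
rewrite /tangent_set /= => /(overlapP hA)[ix jx].
exists (param (i : chart_index TA) z); last exact: tangent_paramK.
by split=> //; exact: (dom_param hA).
Qed.

(** Points of TM carry their fibre components in the chart [chart_at]; the two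
    jacobians leading to it and away from it combine by the cocycle rule. *)
Lemma tangent_transitionE i j z : overlap i j (lsubmx z) ->
  transition (i : chart_index TA) j z =
  row_mx (transition i j (lsubmx z))
    (rsubmx z *m 'J (transition i j) (lsubmx z)).
Proof.
move=> ijx; have /(overlapP hA)[ix jx] := ijx.
have ikx := overlap_chart_at ix; set k := chart_at A _ in ikx.
rewrite [LHS]/transition /= -mulmxA; congr (row_mx _ (_ *m _)).
have kjx : overlap k j (transition i k (lsubmx z)).
  apply/(overlapP hA); rewrite (param_transition hA ikx); split=> //.
  exact/chart_image_coord/dom_chart_at.
rewrite -/k; have -> : coord k (param i (lsubmx z)) = transition i k (lsubmx z)
  by [].
exact/esym/(jacobian_transition_comp hA).
Qed.

Definition transition_comp i j b : 'rV[R]_N -> R :=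
  fun x => transition i j x 0 b.

Lemma tangent_transition_lshift i j z b : overlap i j (lsubmx z) ->
  transition (i : chart_index TA) j z 0 (lshift N b) =
    vlift (transition_comp i j b) z.
Proof. by move=> ijx; rewrite tangent_transitionE // row_mxEl. Qed.

Lemma tangent_transition_rshift i j z b : overlap i j (lsubmx z) ->
  transition (i : chart_index TA) j z 0 (rshift N b) =
    clift (transition_comp i j b) z.
Proof.
move=> ijx; rewrite tangent_transitionE // row_mxEr mxE; apply: eq_bigr => s _.
by congr (_ * _); exact: transition_jacobianE.
Qed.

(** The components of the transition maps are vertical and complete lifts of those
    of the base. *)
Lemma smooth_tangent_atlas : smooth_atlas TA.
Proof.
split.
- by move=> [p v]; exact: dom_chart_at.
- exact: tangent_coordK.
- move=> i j; rewrite tangent_overlap; apply: open_tangent_set.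
  exact: open_overlap.
- move=> i j b; rewrite tangent_overlap.
  have oij := @open_overlap _ _ _ _ hA i j.
  have oT := open_tangent_set oij.
  have st b' := transition_smooth hA i j b'.
  have [b' ->|b' ->] := split_ordP b.
    apply: (smooth_on_congr (f := vlift (transition_comp i j b'))) => //.
      by move=> z ijz; rewrite tangent_transition_lshift.
    exact: (vlift_smooth oij (st b')).
  apply: (smooth_on_congr (f := clift (transition_comp i j b'))) => //.
    by move=> z ijz; rewrite tangent_transition_rshift.
  exact: (clift_smooth oij (st b')).
Qed.

Lemma tangent_jacobian i j z : overlap i j (lsubmx z) ->
  'J (transition (i : chart_index TA) j) z =
  block_mx ('J (transition i j) (lsubmx z))
           (derivation_mx (rsubmx z) (fun x => 'J (transition i j) x)
             (lsubmx z))
           0 ('J (transition i j) (lsubmx z)).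
Proof.
move=> ijx; have oij := @open_overlap _ _ _ _ hA i j.
have Tz : overlap (i : chart_index TA) j z by rewrite tangent_overlap.
have nz : nbhs z (tangent_set (overlap i j)).
  by apply: open_nbhs_nbhs; split=> //; exact: open_tangent_set.
have st b := transition_smooth hA i j b.
have dt b : differentiable (transition_comp i j b) (lsubmx z).
  exact: (smooth_on_differentiable (st b) ijx).
have Jl e b : 'J (transition (i : chart_index TA) j) z e (lshift N b) =
    pderiv e (vlift (transition_comp i j b)) z.
  rewrite (transition_jacobianE smooth_tangent_atlas _ _ Tz);
    apply: near_pderiv.
  by apply: filterS nz => y ijy; rewrite tangent_transition_lshift.
have Jr e b : 'J (transition (i : chart_index TA) j) z e (rshift N b) =
    pderiv e (clift (transition_comp i j b)) z.
  rewrite (transition_jacobianE smooth_tangent_atlas _ _ Tz);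
    apply: near_pderiv.
  by apply: filterS nz => y ijy; rewrite tangent_transition_rshift.
have JE a b : 'J (transition i j) (lsubmx z) a b =
    pderiv a (transition_comp i j b) (lsubmx z).
  exact: transition_jacobianE.
apply/matrixP => e b; have [a ->|a ->] := split_ordP e;
  have [b' ->|b' ->] := split_ordP b.
- by rewrite block_mxEul Jl JE pderiv_lshift_vlift.
- rewrite block_mxEur Jr (pderiv_lshift_clift a oij (st b') ijx) mxE.
  apply: near_derivation; apply: filterS (near_overlap hA ijx) => y ijy.
  by rewrite transition_jacobianE.
- by rewrite block_mxEdl Jl pderiv_rshift_vlift // mxE.
- by rewrite block_mxEdr Jr JE (pderiv_rshift_clift a oij (st b') ijx).
Qed.

End TangentAtlas.

(** * The lifted Poisson tensor in coordinates *)
Section LocalTangent.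
Context {R : realType} {N : nat}.
Implicit Types (z : 'rV[R]_(N + N)).

Lemma row_mx_sum_delta (u v : 'rV[R]_N) :
  row_mx u v = \sum_a u 0 a *: ddx R a + \sum_a v 0 a *: ddy R a.
Proof.
rewrite [LHS]row_sum_delta big_split_ord; congr (_ + _); apply: eq_bigr => a _.
  by rewrite row_mxEl.
by rewrite row_mxEr.
Qed.

Lemma block_mx_sum_delta (B C D E : 'M[R]_N) :
  block_mx B C D E =
  \sum_a \sum_b B a b *: delta_mx (lshift N a) (lshift N b)
  + \sum_a \sum_b C a b *: delta_mx (lshift N a) (rshift N b)
  + (\sum_a \sum_b D a b *: delta_mx (rshift N a) (lshift N b)
  + \sum_a \sum_b E a b *: delta_mx (rshift N a) (rshift N b)).
Proof.
rewrite [LHS]matrix_sum_delta big_split_ord; congr (_ + _);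
  rewrite -big_split; apply: eq_bigr => a _; rewrite big_split_ord;
    congr (_ + _);
  apply: eq_bigr => b _;
  by rewrite ?block_mxEul ?block_mxEur ?block_mxEdl ?block_mxEdr.
Qed.

Lemma wedge_delta m (p q : 'I_m) :
  wedge (delta_mx 0 p) (delta_mx 0 q) = delta_mx p q - delta_mx q p :> 'M[R]_m.
Proof. by rewrite /wedge !trmx_delta !mul_delta_mx. Qed.

(** The matrix of the lifted tensor when [Q] is antisymmetric: the lower left block
    is then minus the transpose of the upper right one. *)
Definition tangent_block (Q : 'rV[R]_N -> 'M[R]_N) z : 'M[R]_(N + N) :=
  block_mx 0 (Q (lsubmx z)) (Q (lsubmx z))
    (derivation_mx (rsubmx z) Q (lsubmx z)).

Lemma row_lshift_tangent_block Q z a :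
  row (lshift N a) (tangent_block Q z) = vfield (fun x => row a (Q x)) z.
Proof.
apply/rowP => e; rewrite mxE; have [b ->|b ->] := split_ordP e.
  by rewrite block_mxEul row_mxEl !mxE.
by rewrite block_mxEur row_mxEr mxE.
Qed.

Lemma row_rshift_tangent_block Q z a :
  row (rshift N a) (tangent_block Q z) = cfield (fun x => row a (Q x)) z.
Proof.
apply/rowP => e; rewrite mxE; have [b ->|b ->] := split_ordP e.
  by rewrite block_mxEdl row_mxEl mxE.
rewrite block_mxEdr row_mxEr [LHS]mxE [RHS]mxE.
suff -> : (fun y => row a (Q y) 0 b) = (fun y => Q y a b) by [].
by apply/funext => y; rewrite mxE.
Qed.

Section Fields.
Variables (U : set 'rV[R]_N) (Q : 'rV[R]_N -> 'M[R]_N).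
Variables (TQ : 'rV[R]_(N + N) -> 'M[R]_(N + N)).
Hypotheses (oU : open U) (sQ : forall a b, smooth_on U (fun x => Q x a b)).
Hypothesis TQE : forall z, tangent_set U z -> TQ z = tangent_block Q z.

Let near_TQ z p q (F : 'rV[R]_(N + N) -> R) v : tangent_set U z ->
  (forall z, tangent_block Q z p q = F z) ->
  derivation v (fun z => TQ z p q) z = derivation v F z.
Proof.
move=> Uz QF; apply: near_derivation.
by apply: filterS (open_nbhs_nbhs (conj (open_tangent_set oU) Uz)) => y /TQE ->.
Qed.

Lemma derivation_tangent_ll v z a b : tangent_set U z ->
  derivation v (fun z => TQ z (lshift N a) (lshift N b)) z = 0.
Proof.
move=> Uz; rewrite (near_TQ (F := fun=> 0)) ?derivation_cst // => y.
by rewrite block_mxEul mxE.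
Qed.

Lemma derivation_tangent_lr v z a b : tangent_set U z ->
  derivation v (fun z => TQ z (lshift N a) (rshift N b)) z =
  derivation v (vlift (fun x => Q x a b)) z.
Proof. by move=> Uz; apply: near_TQ => // y; rewrite block_mxEur. Qed.

Lemma derivation_tangent_rl v z a b : tangent_set U z ->
  derivation v (fun z => TQ z (rshift N a) (lshift N b)) z =
  derivation v (vlift (fun x => Q x a b)) z.
Proof. by move=> Uz; apply: near_TQ => // y; rewrite block_mxEdl. Qed.

Lemma derivation_tangent_rr v z a b : tangent_set U z ->
  derivation v (fun z => TQ z (rshift N a) (rshift N b)) z =
  derivation v (clift (fun x => Q x a b)) z.
Proof. by move=> Uz; apply: near_TQ => // y; rewrite block_mxEdr mxE. Qed.

Lemma row_tangent_l z a : tangent_set U z ->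
  row (lshift N a) (TQ z) = vfield (fun x => row a (Q x)) z.
Proof. by move=> Uz; rewrite TQE // row_lshift_tangent_block. Qed.

Lemma row_tangent_r z a : tangent_set U z ->
  row (rshift N a) (TQ z) = cfield (fun x => row a (Q x)) z.
Proof. by move=> Uz; rewrite TQE // row_rshift_tangent_block. Qed.

Let dQ a b z : tangent_set U z -> differentiable (fun x => Q x a b) (lsubmx z).
Proof. exact: (smooth_on_differentiable (sQ a b)). Qed.

Let srow a : forall b, smooth_on U (fun x => row a (Q x) 0 b).
Proof. by move=> b; under eq_fun do rewrite mxE; exact: sQ. Qed.

(** The rows of the lifted matrix are vertical lifts (for a base index) and complete
    lifts (for a fibre index) of the rows of [Q].  By the rules for lifts, an
    iterated bracket of coordinates vanishes if at least two of them are base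
    coordinates; it is the vertical lift of the one of [Q] if exactly one is, and
    the complete lift if none is. *)
Lemma jacobiator_tangent z : tangent_set U z ->
  (forall x, U x -> forall a b c, jacobiator Q x a b c = 0) ->
  forall p q r, jacobiator TQ z p q r = 0.
Proof.
move=> Uz J0 p q r.
pose K a b c := fun x => derivation (row a (Q x)) (fun y => Q y b c) x.
have K0 x a b c : U x -> K a b c x + K b c a x + K c a b x = 0.
  by move=> Ux; have := J0 x Ux a b c; rewrite /jacobiator /hamiltonian_term.
have J0v a b c : vlift (K a b c) z + vlift (K b c a) z + vlift (K c a b) z = 0.
  exact: K0.
have sK a b c : smooth_on U (K a b c) by apply: derivation_smooth.
have dK a b c : differentiable (K a b c) (lsubmx z).
  exact: (smooth_on_differentiable (sK a b c) Uz).
have J0c a b c : clift (K a b c) z + clift (K b c a) z + clift (K c a b) z = 0.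
  rewrite -(clift_eq0 oU (f := fun x => K a b c x + K b c a x + K c a b x) _
    Uz);
    last by move=> x Ux; exact: K0.
  have d1 := differentiable_funD (dK a b c) (dK b c a).
  by rewrite /clift (derivation_addf _ d1 (dK c a b))
    (derivation_addf _ (dK a b c) (dK b c a)).
have hll a b e : hamiltonian_term TQ z e (lshift N a) (lshift N b) = 0.
  by rewrite /hamiltonian_term derivation_tangent_ll.
have hllr a b c : hamiltonian_term TQ z (lshift N a) (lshift N b) (rshift N c) =
  0.
  rewrite /hamiltonian_term (derivation_tangent_lr _ _ _ Uz) row_tangent_l //.
  exact: vfield_vlift (dQ _ _ Uz).
have hlrl a b c : hamiltonian_term TQ z (lshift N a) (rshift N b) (lshift N c) =
  0.
  rewrite /hamiltonian_term (derivation_tangent_rl _ _ _ Uz) row_tangent_l //.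
  exact: vfield_vlift (dQ _ _ Uz).
have hlrr a b c : hamiltonian_term TQ z (lshift N a) (rshift N b) (rshift N c)
    = vlift (K a b c) z.
  rewrite /hamiltonian_term (derivation_tangent_rr _ _ _ Uz) row_tangent_l //.
  exact: vfield_clift (sQ _ _) Uz.
have hrlr a b c : hamiltonian_term TQ z (rshift N a) (lshift N b) (rshift N c)
    = vlift (K a b c) z.
  rewrite /hamiltonian_term (derivation_tangent_lr _ _ _ Uz) row_tangent_r //.
  exact: cfield_vlift (dQ _ _ Uz).
have hrrl a b c : hamiltonian_term TQ z (rshift N a) (rshift N b) (lshift N c)
    = vlift (K a b c) z.
  rewrite /hamiltonian_term (derivation_tangent_rl _ _ _ Uz) row_tangent_r //.
  exact: cfield_vlift (dQ _ _ Uz).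
have hrrr a b c : hamiltonian_term TQ z (rshift N a) (rshift N b) (rshift N c)
    = clift (K a b c) z.
  rewrite /hamiltonian_term (derivation_tangent_rr _ _ _ Uz) row_tangent_r //.
  by apply: cfield_clift Uz.
rewrite /jacobiator.
have [a ->|a ->] := split_ordP p; have [b ->|b ->] := split_ordP q;
  have [c ->|c ->] := split_ordP r;
  rewrite ?hll ?hllr ?hlrl ?hlrr ?hrlr ?hrrl ?hrrr ?addr0 //.
Qed.

Lemma cfieldl V a : (fun z => cfield V z 0 (lshift N a)) =
  vlift (fun x => V x 0 a).
Proof. by apply/funext => z; rewrite row_mxEl. Qed.

Lemma cfieldr V a : (fun z => cfield V z 0 (rshift N a)) =
  clift (fun x => V x 0 a).
Proof. by apply/funext => z; rewrite row_mxEr mxE. Qed.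

Lemma vfieldl (V : 'rV[R]_N -> 'rV[R]_N) a :
  (fun z => vfield V z 0 (lshift N a)) = fun=> 0.
Proof. by apply/funext => z; rewrite row_mxEl mxE. Qed.

Lemma vfieldr V a : (fun z => vfield V z 0 (rshift N a)) =
  vlift (fun x => V x 0 a).
Proof. by apply/funext => z; rewrite row_mxEr. Qed.

Section LieDerivative.
Variable V : 'rV[R]_N -> 'rV[R]_N.
Hypothesis sV : forall a, smooth_on U (fun x => V x 0 a).

Let D a b := fun x => derivation (V x) (fun y => Q y a b) x.
Let E a b := fun x => derivation (row a (Q x)) (fun y => V y 0 b) x.
Hypothesis L0 : forall x, U x -> forall a b, D a b x = E a b x - E b a x.

Let dV a z : tangent_set U z -> differentiable (fun x => V x 0 a) (lsubmx z).
Proof. exact: (smooth_on_differentiable (sV a)). Qed.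

Let L0v z a b : tangent_set U z -> vlift (D a b) z =
  vlift (E a b) z - vlift (E b a) z.
Proof. by move=> Uz; exact: L0. Qed.

Let L0c z a b : tangent_set U z -> clift (D a b) z =
  clift (E a b) z - clift (E b a) z.
Proof.
move=> Uz; have sE a' b' : smooth_on U (E a' b') by apply: derivation_smooth.
have dE a' b' : differentiable (E a' b') (lsubmx z).
  exact: (smooth_on_differentiable (sE a' b') Uz).
rewrite /clift -(derivation_oppf _ (dE b a)).
rewrite -(derivation_addf _ (dE a b) (differentiable_funN (dE b a))).
apply: near_derivation; apply: filterS (open_nbhs_nbhs (conj oU Uz)) => y Uy.
exact: L0.
Qed.

(** According to the kinds of the two indices, this is [0 = 0], the vertical lift or
    the complete lift of the hypothesis on [V]. *)
Lemma lie_derivative_cfield z p q : tangent_set U z ->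
  derivation (cfield V z) (fun z => TQ z p q) z =
  derivation (row p (TQ z)) (fun z => cfield V z 0 q) z
  - derivation (row q (TQ z)) (fun z => cfield V z 0 p) z.
Proof.
move=> Uz; have [a ->|a ->] := split_ordP p; have [b ->|b ->] := split_ordP q.
- rewrite derivation_tangent_ll // !row_tangent_l // !cfieldl.
  by rewrite !vfield_vlift ?subrr; [|exact: dV|exact: dV].
- rewrite derivation_tangent_lr // row_tangent_l // row_tangent_r // cfieldl
    cfieldr.
  rewrite (cfield_vlift _ (dQ _ _ Uz)) (vfield_clift _ oU (sV b) Uz).
  by rewrite (cfield_vlift _ (dV _ Uz)); exact: L0v.
- rewrite derivation_tangent_rl // row_tangent_l // row_tangent_r // cfieldl
    cfieldr.
  rewrite (cfield_vlift _ (dQ _ _ Uz)) (vfield_clift _ oU (sV a) Uz).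
  by rewrite (cfield_vlift _ (dV _ Uz)); exact: L0v.
- rewrite derivation_tangent_rr // !row_tangent_r // !cfieldr.
  rewrite (cfield_clift oU (sQ a b) sV Uz) (cfield_clift oU (sV b) (srow a) Uz).
  by rewrite (cfield_clift oU (sV a) (srow b) Uz); exact: L0c.
Qed.

(** Only two fibre indices give a condition, the vertical lift of the hypothesis on
    [V]. *)
Lemma lie_derivative_vfield z p q : tangent_set U z ->
  derivation (vfield V z) (fun z => TQ z p q) z =
  derivation (row p (TQ z)) (fun z => vfield V z 0 q) z
  - derivation (row q (TQ z)) (fun z => vfield V z 0 p) z.
Proof.
move=> Uz; have [a ->|a ->] := split_ordP p; have [b ->|b ->] := split_ordP q.
- by rewrite derivation_tangent_ll // !vfieldl !derivation_cst subrr.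
- rewrite derivation_tangent_lr // row_tangent_l // vfieldl vfieldr.
  rewrite (vfield_vlift _ (dQ _ _ Uz)) (vfield_vlift _ (dV _ Uz)).
  by rewrite derivation_cst subrr.
- rewrite derivation_tangent_rl // row_tangent_l // vfieldl vfieldr.
  rewrite (vfield_vlift _ (dQ _ _ Uz)) (vfield_vlift _ (dV _ Uz)).
  by rewrite derivation_cst subrr.
- rewrite derivation_tangent_rr // !row_tangent_r // !vfieldr.
  rewrite (vfield_clift _ oU (sQ a b) Uz) !(cfield_vlift _ (dV _ Uz)).
  exact: L0v.
Qed.
End LieDerivative.

Lemma casimir_vlift (g : 'rV[R]_N -> R) z p : smooth_on U g ->
  (forall x, U x -> forall a, derivation (row a (Q x)) g x = 0) ->
  tangent_set U z -> derivation (row p (TQ z)) (vlift g) z = 0.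
Proof.
move=> sg g0 Uz; have dg := smooth_on_differentiable sg Uz.
have [a ->|a ->] := split_ordP p.
  by rewrite row_tangent_l // (vfield_vlift _ dg).
by rewrite row_tangent_r // (cfield_vlift _ dg); exact: g0.
Qed.

End Fields.

Section Brackets.
Variables (U : set 'rV[R]_N) (V W : 'rV[R]_N -> 'rV[R]_N).
Hypotheses (oU : open U) (sV : forall a, smooth_on U (fun x => V x 0 a)).
Hypothesis sW : forall a, smooth_on U (fun x => W x 0 a).

Let E a := fun x => derivation (V x) (fun y => W y 0 a) x.
Let F a := fun x => derivation (W x) (fun y => V y 0 a) x.
Hypothesis EF : forall x, U x -> forall a, E a x = F a x.

Lemma commute_cfield_vfield z p : tangent_set U z ->
  derivation (cfield V z) (fun z => vfield W z 0 p) z =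
  derivation (vfield W z) (fun z => cfield V z 0 p) z.
Proof.
move=> Uz; have dV a := smooth_on_differentiable (sV a) Uz.
have dW a := smooth_on_differentiable (sW a) Uz.
have [a ->|a ->] := split_ordP p.
  by rewrite vfieldl cfieldl derivation_cst (vfield_vlift _ (dV a)).
rewrite vfieldr cfieldr (cfield_vlift _ (dW a)) (vfield_clift _ oU (sV a) Uz).
exact: EF.
Qed.

Lemma commute_cfield_cfield z p : tangent_set U z ->
  derivation (cfield V z) (fun z => cfield W z 0 p) z =
  derivation (cfield W z) (fun z => cfield V z 0 p) z.
Proof.
move=> Uz; have dV a := smooth_on_differentiable (sV a) Uz.
have dW a := smooth_on_differentiable (sW a) Uz.
have [a ->|a ->] := split_ordP p.
  by rewrite !cfieldl (cfield_vlift _ (dV a)) (cfield_vlift _ (dW a));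
    exact: EF.
rewrite !cfieldr (cfield_clift oU (sW a) sV Uz) (cfield_clift oU (sV a) sW Uz).
apply: near_derivation; apply: filterS (open_nbhs_nbhs (conj oU Uz)) => y Uy.
exact: EF.
Qed.
End Brackets.

End LocalTangent.

(** * Lifted tensor fields on the tangent bundle *)
Section TangentFields.
Context {R : realType} {N : nat} {M : Type} (A : atlas R N M).
Hypothesis hA : smooth_atlas A.
Local Notation TA := (tangent_atlas A).
Implicit Types (X Y : components A 'rV[R]_N) (P : components A 'M[R]_N).
Implicit Types (i j : chart_index A) (z : 'rV[R]_(N + N)).

Lemma complete_liftE X i : complete_lift X i = cfield (X i).
Proof.
apply/funext => z.
rewrite /cfield row_mx_sum_delta /complete_lift; congr (_ + _).
apply: eq_bigr => a _; rewrite mxE -scaler_suml; congr (_ *: _).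
by apply: eq_bigr => s _; rewrite mulrC.
Qed.

Lemma vertical_liftE X i : vertical_lift X i = vfield (X i).
Proof.
apply/funext => z.
rewrite /vfield row_mx_sum_delta /vertical_lift [X in _ = X + _]big1 ?add0r
  // => a _.
by rewrite mxE scale0r.
Qed.

(** In the sum over the [ddy a /\ ddy b], each component occurs twice because of
    antisymmetry, which absorbs the factor one half. *)
Lemma tangent_bivectorE P i z : is_bivector_field P ->
  tangent_set (chart_image i) z -> tangent_bivector P i z =
    tangent_block (P i) z.
Proof.
move=> [sP aP _] iz; rewrite /tangent_bivector /tangent_block
  block_mx_sum_delta.
have aPx a b x : chart_image i x -> P i x a b = - P i x b a.
  by move=> ix; have /matrixP/(_ b a) := aP i x ix; rewrite !mxE.
pose d a b := derivation (rsubmx z) (fun x => P i x a b) (lsubmx z).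
have dE a b : d a b = \sum_s pderiv s (fun x => P i x a b) (lsubmx z) *
  rsubmx z 0 s.
  by apply: eq_bigr => s _; rewrite mulrC.
have ad a b : d b a = - d a b.
  have oi := @open_chart_image _ _ _ _ hA i.
  rewrite /d -(derivation_oppf _ (smooth_on_differentiable (sP i a b) iz)).
  apply: near_derivation; apply: filterS (open_nbhs_nbhs (conj oi iz)) => y iy.
  exact: aPx.
rewrite [X in X + _ + _]big1; last first.
  by move=> a _; rewrite big1 // => b _; rewrite mxE scale0r.
rewrite add0r addrA; congr (_ + _).
  under eq_bigr do under eq_bigr do rewrite wedge_delta scalerBr.
  under eq_bigr do rewrite sumrB.
  rewrite sumrB; congr (_ + _); rewrite exchange_big -sumrN;
    apply: eq_bigr => a _.
  by rewrite -sumrN; apply: eq_bigr => b _; rewrite -scaleNr -aPx.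
under eq_bigr do under eq_bigr do rewrite -scaler_suml -dE wedge_delta scalerBr.
under eq_bigr do rewrite sumrB.
rewrite sumrB [X in _ - X]exchange_big /=.
under [X in _ - X]eq_bigr do under eq_bigr do rewrite ad scaleNr.
under [X in _ - X]eq_bigr do rewrite sumrN.
rewrite sumrN opprK; set S := \sum_(a < N) _.
have -> : S + S = (2 : R) *: S by rewrite scaler_nat mulr2n.
rewrite scalerA mulVf ?scale1r ?pnatr_eq0 // /S.
by apply: eq_bigr => a _; apply: eq_bigr => b _; rewrite mxE.
Qed.

Lemma chart_image_transition i j x : overlap i j x ->
  chart_image j (transition i j x).
Proof. by move=> /(overlapP hA)[_ jx]; exact: chart_image_coord. Qed.

(** Chain rule: the transformed fibre coordinate is the image of [v] under the
    differential of the transition map. *)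
Lemma derivation_mx_transition i j x v p q (G : 'rV[R]_N -> 'M[R]_(p, q)) :
  overlap i j x ->
  (forall a b, smooth_on (chart_image j) (fun x => G x a b)) ->
  derivation_mx (v *m 'J (transition i j) x) G (transition i j x) =
  derivation_mx v (G \o transition i j) x.
Proof.
move=> ijx sG; have jx := chart_image_transition ijx.
apply/matrixP => a b; rewrite mxE [RHS]mxE.
have dF c := transition_differentiable hA c ijx.
by have <- := derivation_comp v dF (smooth_on_differentiable (sG a b) jx).
Qed.

Lemma jacobian_entries_smooth i j a b :
  smooth_on (overlap i j) (fun x => 'J (transition i j) x a b).
Proof.
apply: (smooth_on_congr (f := pderiv a (fun x => transition i j x 0 b))).
- exact: open_overlap.
- by move=> x ijx; rewrite transition_jacobianE.
- by apply: smooth_on_pderiv; exact: transition_smooth.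
Qed.

(** The fibre part of the transformation law is the derivative of the law of [X]
    along the fibre coordinate. *)
Lemma complete_lift_vector_field X : is_vector_field X ->
  is_vector_field (complete_lift X).
Proof.
move=> [sX tX]; split.
- move=> i b; rewrite (tangent_chart_image hA).
  have oi := @open_chart_image _ _ _ _ hA i.
  rewrite complete_liftE.
  have [a ->|a ->] := split_ordP b.
    by rewrite cfieldl; exact: (vlift_smooth oi (sX i a)).
  by rewrite cfieldr; exact: (clift_smooth oi (sX i a)).
- move=> i j z; change (chart_index A) in i, j.
  rewrite (tangent_overlap hA);
    rewrite -[tangent_set _ z]/(overlap i j (lsubmx z)) => ijx.
  rewrite !complete_liftE (tangent_transitionE hA ijx)
    (tangent_jacobian hA ijx).
  rewrite /cfield mul_row_block mulmx0 addr0 row_mxKl row_mxKr; congr row_mx.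
    exact: tX.
  have /(overlapP hA)[ix _] := ijx.
  rewrite (derivation_mx_transition _ ijx); last by move=> a b;
    rewrite (ord1 a).
  rewrite (near_derivation_mx _ (G := fun y => X i y *m 'J (transition i j) y));
    last by apply: filterS (near_overlap hA ijx) => y; exact: tX.
  rewrite derivation_mulmx; first by rewrite addrC.
    by move=> a b; rewrite (ord1 a);
      exact: (smooth_on_differentiable (sX i b) ix).
  by move=> a b; exact: (smooth_on_differentiable
    (jacobian_entries_smooth i j a b) ijx).
Qed.

Lemma vertical_lift_vector_field X : is_vector_field X ->
  is_vector_field (vertical_lift X).
Proof.
move=> [sX tX]; split.
- move=> i b; rewrite (tangent_chart_image hA).
  have oi := @open_chart_image _ _ _ _ hA i.
  rewrite vertical_liftE.
  have [a ->|a ->] := split_ordP b.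
    by rewrite vfieldl; exact: smooth_on_cst.
  by rewrite vfieldr; exact: (vlift_smooth oi (sX i a)).
- move=> i j z; change (chart_index A) in i, j.
  rewrite (tangent_overlap hA);
    rewrite -[tangent_set _ z]/(overlap i j (lsubmx z)) => ijx.
  rewrite !vertical_liftE (tangent_transitionE hA ijx)
    (tangent_jacobian hA ijx).
  rewrite /vfield mul_row_block !mul0mx mulmx0 !add0r row_mxKl; congr row_mx.
  exact: tX.
Qed.

(** The fibre block of the transformation law is the derivative of the law of [P]
    along the fibre coordinate; the derivatives of the two jacobian factors come
    from the off-diagonal block of the jacobian on TM. *)
Lemma tangent_bivector_field P : is_bivector_field P ->
  is_bivector_field (tangent_bivector P).
Proof.
move=> bP; have [sP aP tP] := bP; split.
- move=> i p q; rewrite (tangent_chart_image hA).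
  have oi := @open_chart_image _ _ _ _ hA i.
  have oT := open_tangent_set oi.
  have [a ->|a ->] := split_ordP p; have [b ->|b ->] := split_ordP q.
  + apply: (smooth_on_congr (f := fun=> 0)) => //; last exact: smooth_on_cst.
    by move=> z iz; rewrite tangent_bivectorE // block_mxEul mxE.
  + apply: (smooth_on_congr (f := vlift (fun x => P i x a b))) => //.
      by move=> z iz; rewrite tangent_bivectorE // block_mxEur.
    exact: (vlift_smooth oi (sP i a b)).
  + apply: (smooth_on_congr (f := vlift (fun x => P i x a b))) => //.
      by move=> z iz; rewrite tangent_bivectorE // block_mxEdl.
    exact: (vlift_smooth oi (sP i a b)).
  + apply: (smooth_on_congr (f := clift (fun x => P i x a b))) => //.
      by move=> z iz; rewrite tangent_bivectorE // block_mxEdr mxE.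
    exact: (clift_smooth oi (sP i a b)).
- move=> i z; rewrite (tangent_chart_image hA) => iz.
  have oi := @open_chart_image _ _ _ _ hA i.
  rewrite tangent_bivectorE // tr_block_mx opp_block_mx trmx0 oppr0 aP //.
  congr block_mx; rewrite -derivation_trmx.
  rewrite (near_derivation_mx _ (G := fun x => - P i x)); last first.
    by apply: filterS (open_nbhs_nbhs (conj oi iz)) => y; exact: aP.
  apply/matrixP => a b; rewrite !mxE.
  rewrite -(derivation_oppf _ (smooth_on_differentiable (sP i a b) iz)).
  by apply: near_derivation; near=> y; rewrite mxE.
- move=> i j z; change (chart_index A) in i, j.
  rewrite (tangent_overlap hA);
    rewrite -[tangent_set _ z]/(overlap i j (lsubmx z)) => ijx.
  have /(overlapP hA)[ix _] := ijx.
  have jx := chart_image_transition ijx.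
  rewrite (tangent_jacobian hA ijx) (tangent_transitionE hA ijx).
  rewrite !tangent_bivectorE //; last by rewrite /tangent_set /mkset row_mxKl.
  rewrite /tangent_block row_mxKl row_mxKr.
  rewrite tr_block_mx !mulmx_block trmx0 !mul0mx !mulmx0 !add0r !addr0.
  rewrite -tP //; congr block_mx; rewrite ?mul0mx ?add0r //.
  rewrite (derivation_mx_transition _ ijx); last exact: sP.
  rewrite (near_derivation_mx _ (G := fun y => ('J (transition i j) y)^T *m
     P i y *m 'J (transition i j) y)); last first.
    by apply: filterS (near_overlap hA ijx) => y; exact: tP.
  have dJ a b := smooth_on_differentiable (jacobian_entries_smooth i j a b) ijx.
  have dP a b := smooth_on_differentiable (sP i a b) ix.
  have dJT a b : differentiable (fun y => ('J (transition i j) y)^T a b)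
    (lsubmx z).
    by under eq_fun do rewrite mxE; exact: dJ.
  have dJP a b :
      differentiable (fun y => (('J (transition i j) y)^T *m P i y) a b)
        (lsubmx z).
    under eq_fun do rewrite mxE; apply: differentiable_funsum => c.
    exact: differentiable_funM (dJT a c) (dP c b).
  rewrite (derivation_mulmx _ dJP dJ) (derivation_mulmx _ dJT dP).
  by rewrite derivation_trmx addrC.
Unshelve. all: by end_near. Qed.

End TangentFields.

(** * The deformed lifted Poisson tensor *)
Section TangentPoisson.
Context {R : realType} {N : nat} {M : Type} (A : atlas R N M).
Hypothesis hA : smooth_atlas A.
Implicit Types (X Y : components A 'rV[R]_N) (P : components A 'M[R]_N).
Implicit Types (i : chart_index A) (z : 'rV[R]_(N + N)).

Let oi i : open (chart_image i). Proof. exact: open_chart_image. Qed.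

Lemma tangent_jacobiator P : is_bivector_field P ->
  (forall i x, chart_image i x -> forall a b c, jacobiator (P i) x a b c = 0) ->
  forall (i : chart_index (tangent_atlas A)) z, chart_image i z ->
  forall p q r, jacobiator (tangent_bivector P i) z p q r = 0.
Proof.
move=> bP JP i z; rewrite (tangent_chart_image hA) => iz.
have [sP _ _] := bP.
exact: (jacobiator_tangent (@oi i) (sP i) (fun y => tangent_bivectorE hA bP) iz
  (JP i)).
Qed.

Lemma complete_lift_poisson P X : is_bivector_field P ->
  is_poisson_vector_field P X ->
  is_poisson_vector_field (tangent_bivector P) (complete_lift X).
Proof.
move=> bP hX; have [vX _] := hX; have [sP _ _] := bP; have [sX _] := vX.
split; first exact: complete_lift_vector_field.
move=> i z iz; apply/matrixP => p q.
have [_ aT _] := tangent_bivector_field hA bP.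
rewrite (lie_derivativeE _ _ _ (aT i z iz)) mxE; apply/eqP; rewrite subr_eq0;
  apply/eqP.
move: iz; rewrite (tangent_chart_image hA) complete_liftE => iz.
exact: (lie_derivative_cfield (@oi i) (sP i) (fun y => tangent_bivectorE hA bP)
  (sX i) (poisson_vector_fieldE bP hX) p q iz).
Qed.

Lemma vertical_lift_poisson P X : is_bivector_field P ->
  is_poisson_vector_field P X ->
  is_poisson_vector_field (tangent_bivector P) (vertical_lift X).
Proof.
move=> bP hX; have [vX _] := hX; have [sP _ _] := bP; have [sX _] := vX.
split; first exact: vertical_lift_vector_field.
move=> i z iz; apply/matrixP => p q.
have [_ aT _] := tangent_bivector_field hA bP.
rewrite (lie_derivativeE _ _ _ (aT i z iz)) mxE; apply/eqP; rewrite subr_eq0;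
  apply/eqP.
move: iz; rewrite (tangent_chart_image hA) vertical_liftE => iz.
exact: (lie_derivative_vfield (@oi i) (sP i) (fun y => tangent_bivectorE hA bP)
  (sX i) (poisson_vector_fieldE bP hX) p q iz).
Qed.

Lemma commute_complete_vertical X Y : is_vector_field X -> is_vector_field Y ->
  commute_fields X Y -> commute_fields (complete_lift X) (vertical_lift Y).
Proof.
move=> [sX _] [sY _] XY i z; rewrite (tangent_chart_image hA) => iz.
apply/rowP => p; rewrite lie_bracketE mxE complete_liftE vertical_liftE.
apply/eqP; rewrite subr_eq0; apply/eqP.
exact: (commute_cfield_vfield (@oi i) (sX i) (sY i) (commute_fieldsE XY)).
Qed.

Lemma commute_complete_complete X Y : is_vector_field X -> is_vector_field Y ->
  commute_fields X Y -> commute_fields (complete_lift X) (complete_lift Y).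
Proof.
move=> [sX _] [sY _] XY i z; rewrite (tangent_chart_image hA) => iz.
apply/rowP => p; rewrite lie_bracketE mxE !complete_liftE.
apply/eqP; rewrite subr_eq0; apply/eqP.
exact: (commute_cfield_cfield (@oi i) (sX i) (sY i) (commute_fieldsE XY)).
Qed.

Lemma pullback_param (c : M -> R) (i : chart_index (tangent_atlas A)) :
  (fun q : M * 'rV[R]_N => c q.1) \o param i =
    vlift (c \o param (i : chart_index A)).
Proof. by []. Qed.

Lemma pullback_smooth (c : M -> R) : smooth_fun A c ->
  smooth_fun (tangent_atlas A) (fun q => c q.1).
Proof.
move=> sc i; rewrite pullback_param (tangent_chart_image hA).
exact: (vlift_smooth (@oi i) (sc i)).
Qed.

Lemma pullback_casimir P (c : M -> R) : is_bivector_field P -> smooth_fun A c ->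
  (forall i x, chart_image i x -> forall a,
     derivation (row a (P i x)) (c \o param i) x = 0) ->
  forall (i : chart_index (tangent_atlas A)) z, chart_image i z -> forall p,
  derivation (row p (tangent_bivector P i z))
    ((fun q : M * 'rV[R]_N => c q.1) \o param i) z = 0.
Proof.
move=> bP sc cP i z; rewrite (tangent_chart_image hA) => iz p.
have [sP _ _] := bP.
rewrite pullback_param.
exact: (casimir_vlift (fun y => tangent_bivectorE hA bP) p (sc i) (cP i) iz).
Qed.

End TangentPoisson.

Theorem theorem10 (R : realType) (N : nat) (M : topologicalType)
    (A : atlas R N M) (pi : components A 'M[R]_N) (c : M -> R) (lambda : R)
    (X Y : components A 'rV[R]_N)
    (hM : smooth_manifold A)
    (hpi : is_poisson pi)
    (hc : is_casimir pi c)
    (hX : is_poisson_vector_field pi X)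
    (hY : is_poisson_vector_field pi Y)
    (hXY : commute_fields X Y) :
  is_poisson (deformed_tangent_bivector pi lambda c
                (complete_lift X) (vertical_lift Y)) /\
  is_poisson (deformed_tangent_bivector pi lambda c
                (complete_lift X) (complete_lift Y)).
Proof.
have hA : smooth_atlas A by case: hM.
have [bP _] := hpi; have [vX _] := hX; have [vY _] := hY; have [sc _] := hc.
(* The constant [lambda] is absorbed into the Casimir function. *)
have sg : smooth_fun A (fun p => lambda * c p).
  move=> i; apply: smooth_onM;
    [exact: open_chart_image|exact: smooth_on_cst|exact: sc].
have cg i x : chart_image i x -> forall a,
    derivation (row a (pi i x)) ((fun p => lambda * c p) \o param i) x = 0.
  move=> ix a; have dc := smooth_on_differentiable (sc i) ix.
  rewrite (derivation_mulf _ (differentiable_cst lambda x) dc) derivation_cst.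
  by rewrite (casimir_pderiv hM a bP hc ix) mul0r mulr0 addr0.
have JP i x : chart_image i x -> forall a b d, jacobiator (pi i) x a b d = 0.
  by move=> ix a b d; exact: poisson_jacobiator.
have deform_tangent Z W : is_poisson_vector_field (tangent_bivector pi) Z ->
    is_poisson_vector_field (tangent_bivector pi) W -> commute_fields Z W ->
    is_poisson (deformed_tangent_bivector pi lambda c Z W).
  exact: (deform_poisson (smooth_tangent_atlas hA)
    (tangent_bivector_field hA bP)
    (tangent_jacobiator hA bP JP) (pullback_smooth hA sg)
      (pullback_casimir hA bP sg cg)).
split; apply: deform_tangent.
- exact: complete_lift_poisson.
- exact: vertical_lift_poisson.
- exact: commute_complete_vertical.
- exact: complete_lift_poisson.
- exact: complete_lift_poisson.
- exact: commute_complete_complete.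
Qed.
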